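(* Let $d\ge 1$, let $\Xi=\Upsilon\subset\mathbb{R}^d$ be a (nonempty) open, bounded and connected set, let $\Omega=\Xi+\Upsilon=\{x+y: x\in\Xi,\ y\in\Upsilon\}$, and let $f\in L^2(\Omega)$. Then the operator $\Gamma_f:L^2(\Upsilon)\to L^2(\Xi)$ is positive semidefinite and has finite rank $K$ if and only if there exist distinct $\xi_1,\ldots,\xi_K\in\mathbb{R}^d$ and $c_1,\ldots,c_K>0$ such that $$f(x)=\sum_{k=1}^K c_k e^{\xi_k\cdot x}$$ (as elements of $L^2(\Omega)$).
   Context: Functions are complex valued. The truncated correlation operator $\Gamma_f:L^2(\Upsilon)\to L^2(\Xi)$ is defined by $$\Gamma_f(g)(x)=\int_{\Upsilon} f(x+y)g(y)\,dy,\qquad x\in\Xi.$$ For $a,b\in\mathbb{C}^d$, $a\cdot b=\sum_{m=1}^d a_m b_m$. An operator $A$ on $L^2(\Xi)$ is positive semidefinite (PSD) if $\langle A g,g\rangle\ge 0$ for all $g\in L^2(\Xi)$. The rank of an operator is the dimension of its range. *)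

(* Defs.v *)
From HB Require Import structures.
From mathcomp Require Import all_boot all_order all_algebra.
From mathcomp Require Import complex.
From mathcomp Require Import all_classical all_reals all_analysis.
From mathcomp Require Import measurable_realfun.

Set Implicit Arguments.
Unset Strict Implicit.
Unset Printing Implicit Defensive.

Import Order.TTheory GRing.Theory Num.Theory.
Import numFieldNormedType.Exports.

Local Open Scope classical_set_scope.
Local Open Scope ring_scope.
Local Open Scope complex_scope.

(* The Borel sigma-algebra of R^d, presented as the sigma-algebra generated by
   the d coordinate functions (as the library does for tuples). *)
Fact rV_display : measure_display. Proof. exact: default_measure_display. Qed.

Section rV_measurable.
Context {R : realType} (d : nat).

Definition rV_coord (i : 'I_d) (v : 'rV[R]_d) : measurableTypeR R := v ord0 i.

Let rV_set0 : g_sigma_preimage rV_coord set0.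
Proof. exact: sigma_algebra0. Qed.

Let rV_setC A : g_sigma_preimage rV_coord A -> g_sigma_preimage rV_coord (~` A).
Proof. exact: sigma_algebraC. Qed.

Let rV_bigcup (F : (set 'rV[R]_d)^nat) :
  (forall i, g_sigma_preimage rV_coord (F i)) ->
  g_sigma_preimage rV_coord (\bigcup_i (F i)).
Proof. exact: sigma_algebra_bigcup. Qed.

HB.instance Definition _ := @isMeasurable.Build rV_display
  'rV[R]_d (g_sigma_preimage rV_coord) rV_set0 rV_setC rV_bigcup.

Lemma measurable_rV_coord (i : 'I_d) :
  measurable_fun [set: 'rV[R]_d] (rV_coord i).
Proof.
move=> _ Y mY; rewrite setTI; apply: sub_sigma_algebra => /=.
rewrite -bigcup_seq/=; exists i => /=; first by rewrite mem_index_enum.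
by exists Y => //; rewrite setTI.
Qed.

Lemma measurable_fun_rVP d1 (T : measurableType d1) (f : T -> 'rV[R]_d) :
  measurable_fun [set: T] f <->
  forall i, measurable_fun [set: T] (rV_coord i \o f).
Proof.
split=> [mf i|mf].
  exact: measurableT_comp (measurable_rV_coord i) mf.
have H : g_sigma_preimage (fun i => rV_coord i \o f) `<=` measurable.
  apply: smallest_sub; first exact: sigma_algebra_measurable.
  rewrite -bigcup_seq/=; apply: bigcup_sub => i _ A [B mB <-].
  exact: mf.
rewrite g_sigma_preimage_comp in H.
by move=> _ A mA; apply: H; exists A.
Qed.

Lemma open_measurable_rV (A : set 'rV[R]_d) : open A -> measurable A.
Proof.
move=> oA.
pose B (p : 'rV[rat]_d * nat) : set 'rV[R]_d :=
  ball (map_mx ratr p.1 : 'rV[R]_d) (p.2.+1%:R^-1 : R).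
have mB p : measurable (B p).
  rewrite (_ : B p = \bigcap_(i : 'I_d)
      (rV_coord i @^-1` ball (ratr (p.1 ord0 i) : R) (p.2.+1%:R^-1))).
    apply: fin_bigcap_measurable; first exact: finite_finset.
    move=> i _; rewrite -[X in measurable X]setTI.
    by apply: measurable_rV_coord => //; apply: open_measurable; exact: (@ball_open R R^o).
  apply/seteqP; split => v.
    by move=> Bv i _; have := Bv.2 ord0 i; rewrite mxE.
  move=> Bv; split; first by rewrite invr_gt0.
  by move=> i j; rewrite ord1 mxE; exact: Bv.
rewrite (_ : A = \bigcup_(p in [set p | B p `<=` A]) B p).
  rewrite bigcup_mkcond; apply: countable_bigcupT_measurable => // p.
  by case: ifPn.
apply/seteqP; split => [v Av|v [p pA]]; last exact: pA.
have [e /= e0 eA] : nbhs_ball v A by rewrite nbhs_ballE; exact: oA.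
pose n := Num.truncn (2 / e).
have ne : n.+1%:R^-1 + n.+1%:R^-1 <= e.
  rewrite -mulr2n -[leLHS]mulr_natl ler_pdivrMr// -ler_pdivrMl// mulrC.
  by rewrite ltW// truncnS_gt.
have n0 : 0 < n.+1%:R^-1 :> R by rewrite invr_gt0.
have /choice[q qP] (i : 'I_d) : exists q : rat,
    ball (ratr q : R) n.+1%:R^-1 (v ord0 i).
  have [q] := @rat_in_itvoo R (v ord0 i) (v ord0 i + n.+1%:R^-1) ltac:(by rewrite ltrDl).
  rewrite in_itv/= => /andP[vq qv]; exists q.
  by rewrite /ball/= gtr0_norm ?subr_gt0// ltrBlDl.
have Bv : B (\row_i q i, n) v.
  split => // i j; rewrite ord1 !mxE; exact: qP.
exists (\row_i q i, n) => // w Bw; apply: eA.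
apply: (le_ball ne); apply: (ball_triangle _ Bw).
exact/ball_sym.
Qed.

End rV_measurable.

Section rV_lebesgue.
Context {R : realType}.

Definition rV_cons d (p : measurableTypeR R * 'rV[R]_d) : 'rV[R]_d.+1 :=
  \row_i (if unlift ord0 i is Some j then p.2 ord0 j else p.1).

Lemma measurable_rV_cons d : measurable_fun setT (@rV_cons d).
Proof.
apply/measurable_fun_rVP => i.
case: (unliftP ord0 i) => [j|] ->.
  rewrite (_ : _ \o _ = rV_coord j \o snd).
    exact: measurableT_comp (measurable_rV_coord j) _.
  by apply/funext => p; rewrite /rV_coord /rV_cons /= mxE liftK.
rewrite (_ : _ \o _ = fst)//; apply/funext => p.
by rewrite /rV_coord /rV_cons /= mxE unlift_none.
Qed.

Definition rV_cons_measure d (nu : {sigma_finite_measure set 'rV[R]_d -> \bar R})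
    : set 'rV[R]_d.+1 -> \bar R :=
  pushforward (@lebesgue_measure R \x nu)%E (@rV_cons d).

Section rV_cons_measure.
Variables (d : nat) (nu : {sigma_finite_measure set 'rV[R]_d -> \bar R}).

Let cons0 : rV_cons_measure nu set0 = 0%E.
Proof. by rewrite /rV_cons_measure /pushforward preimage_set0 measure0. Qed.

Let cons_ge0 A : (0 <= rV_cons_measure nu A)%E.
Proof. by rewrite /rV_cons_measure /pushforward; apply: integral_ge0 => x _; exact: measure_ge0. Qed.

Let cons_sigma_additive : semi_sigma_additive (rV_cons_measure nu).
Proof.
have mc := @measurable_rV_cons d.
move=> F mF tF mUF; rewrite /rV_cons_measure /pushforward preimage_bigcup.
apply: measure_semi_sigma_additive.
- by move=> n; rewrite -[X in measurable X]setTI; exact: mc.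
- apply/trivIsetP => /= i j _ _ ij; rewrite -preimage_setI.
  by move/trivIsetP : tF => /(_ _ _ _ _ ij) ->//; rewrite preimage_set0.
- by rewrite -preimage_bigcup -[X in measurable X]setTI; exact: mc.
Qed.

HB.instance Definition _ := isMeasure.Build _ _ _ (rV_cons_measure nu)
  cons0 cons_ge0 cons_sigma_additive.

Let cons_sigma_finite : sigma_finite setT (rV_cons_measure nu).
Proof.
have /sigma_finiteP[F [TF ndF Foo]] := sigma_finiteT (@lebesgue_measure R).
have /sigma_finiteP[G [TG ndG Goo]] := sigma_finiteT nu.
pose h (v : 'rV[R]_d.+1) : measurableTypeR R * 'rV[R]_d :=
  (rV_coord ord0 v, \row_j v ord0 (lift ord0 j)).
have mh : measurable_fun setT h.
  apply: measurable_fun_pair; first exact: measurable_rV_coord.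
  apply/measurable_fun_rVP => i.
  rewrite (_ : _ \o _ = rV_coord (lift ord0 i)).
    exact: measurable_rV_coord.
  by apply/funext => v; rewrite /rV_coord /= mxE.
have hK : cancel (@rV_cons d) h.
  move=> [x v]; rewrite /h /rV_coord mxE unlift_none; congr pair.
  by apply/rowP => j; rewrite !mxE liftK.
exists (fun n => h @^-1` (F n `*` G n)).
  apply/esym; rewrite -subTset => v _.
  have [i _ Fi] : (\bigcup_n F n) (h v).1 by rewrite -TF.
  have [j _ Gj] : (\bigcup_n G n) (h v).2 by rewrite -TG.
  exists (maxn i j) => //; split.
    by apply: (subsetPset _ _ (ndF _ _ (leq_maxl i j))).
  by apply: (subsetPset _ _ (ndG _ _ (leq_maxr i j))).
move=> n; have [mF Fn] := Foo n; have [mG Gn] := Goo n; split.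
  by rewrite -[X in measurable X]setTI; apply: mh => //; exact: measurableX.
rewrite /rV_cons_measure /pushforward -comp_preimage.
rewrite (_ : h \o _ = id); last by apply/funext => p; exact: hK.
by rewrite preimage_id product_measure1E// lte_mul_pinfty// ge0_fin_numE.
Qed.

HB.instance Definition _ := Measure_isSigmaFinite.Build _ _ _
  (rV_cons_measure nu) cons_sigma_finite.

End rV_cons_measure.

(* Lebesgue measure on R^d, as the d-fold product of Lebesgue measure on R *)
Fixpoint rV_lebesgue d : {sigma_finite_measure set 'rV[R]_d -> \bar R} :=
  match d with
  | 0%N => \d_(0 : 'rV[R]_0)
  | d'.+1 => rV_cons_measure (rV_lebesgue d')
  end.

End rV_lebesgue.
Arguments rV_lebesgue {R} d.

Section L2.
Context {R : realType} {d : nat}.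
Local Notation mu := (@rV_lebesgue R d).
Implicit Types (D : set 'rV[R]_d) (g h : 'rV[R]_d -> R[i]).

Definition cintegral D h : R[i] :=
  Rintegral mu D (fun x => complex.Re (h x)) +i*
  Rintegral mu D (fun x => complex.Im (h x)).

(* Elements of L^2(D) are handled through representatives, total functions
   whose values outside D are irrelevant; equality in L^2(D) is [L2_eq D].
   [measurable_fun D] holds vacuously for non-measurable D, but D is open
   wherever this is used, see [open_measurable_rV]. *)
Definition L2 D : set ('rV[R]_d -> R[i]) :=
  [set h : 'rV[R]_d -> R[i] |
          [/\ measurable_fun D (fun x => complex.Re (h x)),
               measurable_fun D (fun x => complex.Im (h x)) &
               (\int[mu]_(x in D) (Normc.normc (h x) ^+ 2)%:E < +oo)%E]].

Definition L2_eq D g h : Prop := ae_eq mu D g h.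

Definition L2_inner D g h : R[i] := cintegral D (fun x => g x * (h x)^*).

(* The dimension of the image of V in L^2(D) is K: V contains a family of K
   elements, linearly independent in L^2(D), which spans V modulo [L2_eq D]. *)
Definition L2_dim D (V : set ('rV[R]_d -> R[i])) (K : nat) : Prop :=
  exists e : 'I_K -> 'rV[R]_d -> R[i],
    [/\ forall k, V (e k),
        forall a : 'I_K -> R[i],
          L2_eq D (fun x => \sum_(k < K) a k * e k x) (fun=> 0) ->
          forall k, a k = 0 &
        forall h, V h -> exists a : 'I_K -> R[i],
          L2_eq D h (fun x => \sum_(k < K) a k * e k x)].

Implicit Type A : ('rV[R]_d -> R[i]) -> ('rV[R]_d -> R[i]).

(* A is viewed as an operator from L^2(Ups) to L^2(Xi). *)
Definition L2_has_rank (Ups Xi : set 'rV[R]_d) A (K : nat) : Prop :=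
  L2_dim Xi (A @` L2 Ups) K.

(* [0 <= z] in R[i] means that z is real and nonnegative. *)
Definition L2_psd (Xi : set 'rV[R]_d) A : Prop :=
  forall g, L2 Xi g -> 0 <= L2_inner Xi (A g) g.

Definition corr_op (Ups : set 'rV[R]_d) (f g : 'rV[R]_d -> R[i]) :
    'rV[R]_d -> R[i] :=
  fun x => cintegral Ups (fun y => f (x + y) * g y).

End L2.

Definition dotv {S : pzRingType} {d : nat} (a b : 'rV[S]_d) : S :=
  \sum_(m < d) a ord0 m * b ord0 m.

Definition set_add {V : zmodType} (A B : set V) : set V :=
  [set x + y | x in A & y in B].

(* Main.v *)
Require Import Defs.
From mathcomp Require Import all_boot all_order all_algebra.
From mathcomp Require Import complex.
From mathcomp Require Import all_classical all_reals all_analysis.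
From mathcomp Require Import measurable_realfun.
From mathcomp Require Import ring lra.

(** The kernel f(x + y) is positive semidefinite of finite rank, hence of the form
    u(x).u(y) for a curve u in some R^n.  As it depends on x + y only, moving x by v
    is adjoint to moving y by v, so that translations act on R^n by commuting
    symmetric matrices.  In a common eigenbasis each coordinate of u is multiplied by
    a positive factor lambda_k(v) under a translation by v; these factors are
    multiplicative and continuous, so lambda_k(v) = exp(xi_k.v), every coordinate of u
    is a multiple gamma_k exp(xi_k.x), and f(x + y) is the sum of the
    |gamma_k|^2 exp(xi_k.(x + y)).

    The curve u.  The form (g, h) |-> \int \int f(x + y) g(y) h(x) dy dx is evaluated
    on real Lipschitz functions vanishing off X.  It is symmetric by Fubini; complex
    positivity says that its real part is positive semidefinite and that its imaginary
    part is alternating, hence zero.  The rank bounds the size of an orthonormal family,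
    and a maximal orthonormal family g_i represents the whole form
    ([maximal_orthonormal]).  With u_i(x) = \int f(x + y) g_i(y) dy this says that
    f(x + y) = \sum_i u_i(x) u_i(y) for every x and almost every y
    ([separated_kernel]).  The u_i inherit continuity from the g_i, so what holds almost
    everywhere for u holds everywhere.

    The matrices of the translations.  They are defined by moving points of a small ball
    on which the values of u span R^n.  Any ball will do: a linear form that vanishes on u
    over some ball vanishes on u over all of X ([unique_continuation]), because near any
    point the span of u over small balls is constant and is preserved by small
    translations, and X is connected.  Then come [shift_matrices],
    [hermitian_codiagonalization], [local_exponential] and a second use of connectedness,
    which extends the exponential law from small translations to X
    ([translation_kernel_exponentials]).

    Conversely, if f is such a sum and m_k(g) = \int exp(xi_k.y) g(y) dy, then
    Gamma_f g = \sum_k c_k m_k(g) exp(xi_k.x) and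
    <Gamma_f g, g> = \sum_k c_k |m_k(g)|^2 ([exponentials_psd]).  Distinct exponentials
    are independent on any open set ([expv_independent]), so their Gram matrix is
    invertible and the rank is the number of terms ([exponentials_rank]).  Together with
    the uniqueness of the dimension this also identifies n with the rank. *)


Set Implicit Arguments.
Unset Strict Implicit.
Unset Printing Implicit Defensive.
Import Order.TTheory GRing.Theory Num.Theory.
Import numFieldNormedType.Exports.

Local Open Scope classical_set_scope.
Local Open Scope ring_scope.
Local Open Scope complex_scope.


(** * Translation invariance and cubes for Lebesgue measure on R^d *)

Section translation1.
Context {R : realType}.

Lemma lebesgue_measure_translation (a : R) (A : set (measurableTypeR R)) :
  measurable A ->
  lebesgue_measure ((fun x : measurableTypeR R => a + x : measurableTypeR R) @^-1` A) =
  lebesgue_measure A.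
Proof.
pose t : measurableTypeR R -> measurableTypeR R := fun x => a + x.
have mt : measurable_fun setT t by exact: measurable_funD.
move=> mA; symmetry.
apply: (@lebesgue_measure_unique R (pushforward (@lebesgue_measure R) t)) => //.
move=> _ [[x y] /= _ <-]; rewrite /pushforward /=.
rewrite (_ : _ @^-1` _ = `]x - a, y - a]%classic); last first.
  by apply/seteqP; split => z /=; rewrite /t !in_itv/= ltrBlDl lerBrDl.
rewrite !lebesgue_measure_itv/= !lte_fin ltrBlDr subrK.
by case: ifPn => // _; rewrite -!EFinB opprB addrA subrK.
Qed.

End translation1.

Section rV_measure.
Context {R : realType}.
Local Notation mu := (@rV_lebesgue R).

Lemma measurable_rV_translation d (a : 'rV[R]_d) :
  measurable_fun setT (fun x : 'rV[R]_d => a + x).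
Proof.
apply/measurable_fun_rVP => i.
rewrite (_ : _ \o _ = (fun x => a ord0 i + rV_coord i x)).
  by apply: measurable_funD => //; exact: measurable_rV_coord.
by apply/funext => x; rewrite /rV_coord /= mxE.
Qed.

Lemma measurable_preimage d1 d2 (T1 : measurableType d1) (T2 : measurableType d2)
  (f : T1 -> T2) (A : set T2) :
  measurable_fun setT f -> measurable A -> measurable (f @^-1` A).
Proof. by move=> mf mA; rewrite -[X in measurable X]setTI; exact: mf. Qed.

(** By induction on the dimension: a section of a translate of A is a translate of a
    section of A, which reduces the claim to the line. *)
Lemma rV_lebesgue_translation d (a : 'rV[R]_d) (A : set 'rV[R]_d) :
  measurable A -> mu d ((fun x => a + x) @^-1` A) = mu d A.
Proof.
elim: d a A => [|d IH] a A mA.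
  by congr (mu 0 _); apply/seteqP; split => x /=; rewrite (thinmx0 (a + x)) (thinmx0 x).
rewrite /= /rV_cons_measure /pushforward /product_measure1 /=.
pose a0 : R := a ord0 ord0; pose a' : 'rV[R]_d := \row_j a ord0 (lift ord0 j).
set B := rV_cons (d:=d) @^-1` A.
have mB : measurable B by apply: measurable_preimage => //; exact: measurable_rV_cons.
transitivity (\int[@lebesgue_measure R]_x ((fun x => mu d (xsection B x)) (a0 + x)%R))%E.
  apply: eq_integral => x _ /=.
  rewrite -(IH a' (xsection B (a0 + x))); last first.
    by apply: (@measurable_xsection _ _ (measurableTypeR R) _ B).
  congr (mu d _); apply/seteqP; split => y; rewrite /xsection /= !inE /B/=.
    suff -> : a + rV_cons (x, y) = rV_cons (a0 + x, a' + y) by [].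
    apply/rowP => i; rewrite !mxE; case: unliftP => [j|] -> //=.
    by rewrite !mxE.
  suff -> : a + rV_cons (x, y) = rV_cons (a0 + x, a' + y) by [].
  apply/rowP => i; rewrite !mxE; case: unliftP => [j|] -> //=.
  by rewrite !mxE.
pose t : measurableTypeR R -> measurableTypeR R := fun x => a0 + x.
have mt : measurable_fun setT t by exact: measurable_funD.
transitivity (\int[pushforward (@lebesgue_measure R) t]_x (mu d (xsection B x)))%E.
  rewrite ge0_integral_pushforward//=.
  exact: (@measurable_fun_xsection _ _ (measurableTypeR R) _ R (mu d) B mB).
by apply: eq_measure_integral => C mC _; exact: lebesgue_measure_translation.
Qed.

Lemma rV_lebesgue_cube d (a : 'rV[R]_d) (r : R) : 0 < r ->
  mu d [set x | forall i, `|x ord0 i - a ord0 i| < r] = ((r *+ 2) ^+ d)%:E.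
Proof.
move=> r0; elim: d a => [|d IH] a.
  by rewrite /= expr0 diracE mem_set//= => -[].
rewrite /= /rV_cons_measure /pushforward.
pose a0 : R := a ord0 ord0; pose a' : 'rV[R]_d := \row_j a ord0 (lift ord0 j).
rewrite (_ : _ @^-1` _ = `]a0 - r, a0 + r[%classic `*`
     [set x : 'rV[R]_d | forall i, `|x ord0 i - a' ord0 i| < r]); last first.
  apply/seteqP; split => -[x y] /=.
    move=> H; split.
      have := H ord0; rewrite mxE unlift_none /= ltr_distl in_itv/=; apply.
    move=> i; have := H (lift ord0 i).
    by rewrite !mxE liftK.
  move=> [H1 H2] i; rewrite mxE; case: unliftP => [j|] -> /=.
    by have := H2 j; rewrite mxE.
  by rewrite ltr_distl; move: H1; rewrite in_itv.
rewrite product_measure1E//=; last first.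
  rewrite (_ : mkset _ = \bigcap_(i : 'I_d) (rV_coord i @^-1` [set x : R | `|x - a' ord0 i| < r])).
    apply: (@fin_bigcap_measurable _ 'rV[R]_d); first exact: finite_finset.
    move=> i _; apply: measurable_preimage; first exact: measurable_rV_coord.
    rewrite (_ : mkset _ = ball (a' ord0 i : R) r).
      by apply: open_measurable; exact: (@ball_open R R^o).
    by apply/seteqP; split => x; rewrite /ball/= distrC.
  by apply/seteqP; split => [x H i _|x H i]; [exact: H|exact: (H i)].
rewrite [X in (_ * X)%E]IH lebesgue_measure_itv/= lte_fin ltrBlDr -addrA ltrDl addr_gt0//.
rewrite -EFinB -EFinM; congr (_%:E); rewrite exprS; congr (_ * _).
by rewrite opprB addrC addrA subrK mulr2n.
Qed.

End rV_measure.

Section rV_measure_facts.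
Context {R : realType} {d : nat}.
Local Notation V := 'rV[R]_d.
Local Notation mu := (@rV_lebesgue R d).
Implicit Types (A D U : set V) (a x y v : V).

Lemma rV_ballE a (r : R) : 0 < r ->
  ball a r = [set x : V | forall i, `|x ord0 i - a ord0 i| < r].
Proof.
move=> r0; apply/seteqP; split => x.
  by move=> [_ H] i; have := H ord0 i; rewrite /ball/= distrC.
move=> /= H; split => // i j; rewrite ord1.
by rewrite /ball/= distrC; exact: H.
Qed.

Lemma rV_lebesgue_ball a (r : R) : 0 < r -> mu (ball a r) = ((r *+ 2) ^+ d)%:E.
Proof. by move=> r0; rewrite rV_ballE//; exact: rV_lebesgue_cube. Qed.

Lemma measurable_rV_ball a (r : R) : measurable (ball a r : set V).
Proof. by apply: open_measurable_rV; exact: (@ball_open R V). Qed.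

Lemma bounded_subset_ball A : bounded_set A -> exists2 M : R, 0 < M & A `<=` ball 0 M.
Proof.
move=> [M [_ AM]]; exists (`|M| + 2); first by rewrite ltr_wpDl.
move=> x Ax; rewrite -ball_normE /ball_/= sub0r normrN.
apply: (@le_lt_trans _ _ (`|M| + 1)); last by rewrite ltrD2l ltr1n.
by apply: AM => //; apply: (le_lt_trans (ler_norm M)); rewrite ltrDl.
Qed.

Lemma bounded_rV_lebesgue_lty A : measurable A -> bounded_set A -> (mu A < +oo)%E.
Proof.
move=> mA /bounded_subset_ball[M M0 AM].
apply: (@le_lt_trans _ _ (mu (ball 0 M))).
  by apply: le_measure => //; rewrite inE//; exact: measurable_rV_ball.
by rewrite rV_lebesgue_ball// ltry.
Qed.

(** A point where the two functions differ has a ball around it on which they differ,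
    and balls have positive measure. *)
Lemma ae_eq_open_eq U (f g : V -> R) : open U ->
  (forall x, U x -> {for x, continuous f}) ->
  (forall x, U x -> {for x, continuous g}) ->
  ae_eq mu U f g -> forall x, U x -> f x = g x.
Proof.
move=> oU cf cg [N [mN N0 UN]] x Ux; apply/eqP; apply: contrapT => /negP fgx.
pose W := [set y | U y /\ f y - g y != 0].
have [r /= r0 rW] : nbhs_ball x W.
  have cfg : (fun y => f y - g y) y @[y --> x] --> f x - g x.
    by apply: (@cvgB _ R^o _ (nbhs x)) ; [exact: (cf x Ux)|exact: (cg x Ux)].
  rewrite nbhs_ballE; near=> y; split; first by near: y; exact: oU.
  near: y; apply: (cfg [set z : R | z != 0]); apply: open_nbhs_nbhs.
  by split; [exact: open_neq|rewrite /= subr_eq0].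
have : (mu (ball x r) <= mu N)%E.
  apply: le_measure; rewrite ?inE//; first exact: measurable_rV_ball.
  move=> y /rW[Uy fgy]; apply: UN => /= /(_ Uy) fgE.
  by move: fgy; rewrite fgE subrr eqxx.
by rewrite N0 rV_lebesgue_ball// lee_fin leNgt exprn_gt0// pmulrn_lgt0.
Unshelve. all: by end_near. Qed.

Lemma negligible_rV_translation a A :
  mu.-negligible A -> mu.-negligible ((fun x => a + x) @^-1` A).
Proof.
move=> [N [mN N0 AN]]; exists ((fun x => a + x) @^-1` N); split.
- by apply: measurable_preimage => //; exact: measurable_rV_translation.
- by rewrite rV_lebesgue_translation.
- by move=> x /=; exact: AN.
Qed.

Lemma integrable_rV_translation a (f : V -> R) :
  mu.-integrable setT (EFin \o f) -> mu.-integrable setT (EFin \o (fun x => f (a + x))).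
Proof.
move=> /integrableP[mf fi]; apply/integrableP; split.
  have := measurableT_comp mf (measurable_rV_translation a); exact.
apply: le_lt_trans fi.
rewrite -[X in (X <= _)%E]/(\int[mu]_x ((fun z => `|(f z)%:E|%E) (a + x)%R))%E.
rewrite -[X in (X <= _)%E](@ge0_integral_pushforward _ _ _ _ _ _
    (measurable_rV_translation a) mu setT (fun z => `|(f z)%:E|%E))//; last first.
  exact: measurableT_comp.
rewrite le_eqVlt; apply/orP; left; apply/eqP.
apply: eq_measure_integral => [|mt A mA _]; first exact: measurable_rV_translation.
exact: rV_lebesgue_translation.
Qed.

Lemma Rintegral_rV_translation a (f : V -> R) :
  mu.-integrable setT (EFin \o f) ->
  \int[mu]_x f (a + x) = \int[mu]_x f x.
Proof.
move=> fi; rewrite /Rintegral; congr fine.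
have mf := measurable_int _ fi.
have H := @integral_pushforward _ _ _ _ _ _ (measurable_rV_translation a) mu setT
  (EFin \o f) mf (integrable_rV_translation a fi) measurableT.
rewrite -[LHS]H.
apply: eq_measure_integral => [|mt A mA _]; first exact: measurable_rV_translation.
exact: rV_lebesgue_translation.
Qed.

Lemma rat_rV_dense U : open U -> U !=set0 -> exists q : 'rV[rat]_d, U (map_mx ratr q).
Proof.
move=> oU [v Uv].
have [e /= e0 eU] : nbhs_ball v U by rewrite nbhs_ballE; exact: oU.
have /choice[q qP] (i : 'I_d) : exists q : rat, `|(ratr q : R) - v ord0 i| < e.
  have [q] := @rat_in_itvoo R (v ord0 i) (v ord0 i + e) ltac:(by rewrite ltrDl).
  rewrite in_itv/= => /andP[vq qv]; exists q.
  by rewrite gtr0_norm ?subr_gt0// ltrBlDl.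
exists (\row_i q i); apply: eU; rewrite rV_ballE// => i.
by rewrite !mxE; exact: qP.
Qed.

End rV_measure_facts.

(** * Lipschitz test functions *)

Section test_functions.
Context {R : realType} {d : nat}.
Local Notation V := 'rV[R]_d.
Local Notation mu := (@rV_lebesgue R d).
Implicit Types (X U : set V) (f g h : V -> R).

Lemma continuous_rV_coord (i : 'I_d) : continuous (fun x : V => x ord0 i).
Proof. exact: coord_continuous. Qed.

Lemma continuous_measurable_rV f : continuous f -> measurable_fun setT f.
Proof.
move=> cf; apply: (measurability _ (RGenOpens.measurableE R)).
move=> _ [_ [a [b ->] <-]]; rewrite setTI; apply: open_measurable_rV.
by move/continuousP: cf; apply; exact: interval_open.
Qed.

(** The Borel sets generated by the coordinates are also generated by the open sets, a
    family closed under intersection: this is what Dynkin arguments need. *)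
Lemma measurable_rVE : @measurable _ V = <<s [set U : set V | open U] >>.
Proof.
apply/seteqP; split => A.
  apply: smallest_sub; first exact: smallest_sigma_algebra.
  rewrite -bigcup_seq/= => B [i _ [C mC <-]].
  pose T := g_sigma_algebraType [set U : set V | open U].
  have mi : measurable_fun (setT : set T) (fun x : T => (x : V) ord0 i : measurableTypeR R).
    apply: (measurability _ (RGenOpens.measurableE R)).
    move=> _ [_ [a [b ->] <-]]; rewrite setTI; apply: sub_sigma_algebra => /=.
    by move: (@continuous_rV_coord i) => /continuousP; apply; exact: interval_open.
  by have := mi measurableT C mC.
by apply: smallest_sub; [exact: sigma_algebra_measurable|move=> U; exact: open_measurable_rV].
Qed.

Definition lipschitz_bound f (L : R) := forall x y, `|f x - f y| <= L * `|x - y|.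

Lemma lipschitz_bound_continuous f L : lipschitz_bound f L -> continuous f.
Proof.
move=> fL x; apply/(@cvgrPdist_le R R^o V (nbhs x)) => /= e e0.
pose L' := `|L| + 1; have L0 : 0 < L' by rewrite ltr_wpDl.
have e'0 : 0 < L'^-1 * e by rewrite mulr_gt0// invr_gt0.
apply/nbhs_ballP; exists (L'^-1 * e) => // y; rewrite -ball_normE /ball_/= => xy.
apply: (le_trans (fL x y)); apply: (@le_trans _ _ (L' * `|x - y|)).
  by apply: ler_wpM2r => //; apply: (le_trans (ler_norm L)); rewrite lerDl.
by rewrite -ler_pdivlMl// ltW.
Qed.

(** The test functions.  Lipschitz functions that vanish off X are bounded and
    integrable when X is open and bounded, they separate integrable functions on X, and their
    correlations with an integrable function are again Lipschitz. *)
Definition lip_test X g := (forall x, ~ X x -> g x = 0) /\ exists L, lipschitz_bound g L.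

Lemma lip_test0 X : lip_test X (fun=> 0).
Proof. by split=> //; exists 0 => x y; rewrite subrr normr0 mul0r. Qed.

Lemma lip_testD X g h : lip_test X g -> lip_test X h -> lip_test X (fun x => g x + h x).
Proof.
move=> [gX [L gL]] [hX [M hM]]; split=> [x Xx|]; first by rewrite gX// hX// addr0.
exists (L + M) => x y; rewrite opprD addrACA mulrDl.
by apply: (le_trans (ler_normD _ _)); apply: lerD; [exact: gL|exact: hM].
Qed.

Lemma lip_testZ X (a : R) g : lip_test X g -> lip_test X (fun x => a * g x).
Proof.
move=> [gX [L gL]]; split=> [x Xx|]; first by rewrite gX// mulr0.
exists (`|a| * L) => x y; rewrite -mulrBr normrM -mulrA.
by apply: ler_wpM2l => //; exact: gL.
Qed.

Lemma lip_test_continuous X g : lip_test X g -> continuous g.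
Proof. by move=> [_ [L gL]]; exact: lipschitz_bound_continuous gL. Qed.

Lemma lip_test_measurable X g : lip_test X g -> measurable_fun setT g.
Proof. by move=> /lip_test_continuous; exact: continuous_measurable_rV. Qed.

Lemma lip_test_bounded X g : bounded_set X -> lip_test X g -> exists M, forall x, `|g x| <= M.
Proof.
move=> /bounded_subset_ball[M M0 XM] [gX [L gL]].
exists (`|g 0| + `|L| * M) => x.
have [Xx|nXx] := pselect (X x); last first.
  by rewrite gX// normr0 addr_ge0// mulr_ge0// ltW.
rewrite -lerBlDl; apply: (le_trans (lerB_dist _ _)); apply: (le_trans (gL _ _)).
rewrite subr0; apply: (le_trans (ler_wpM2r (normr_ge0 _) (ler_norm L))).
apply: ler_wpM2l => //.
by have := XM x Xx; rewrite -ball_normE /ball_/= sub0r normrN => /ltW.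
Qed.

Lemma bounded_fun_within (A : set V) g (M : R) : (forall x, `|g x| <= M) -> [bounded g x | x in A].
Proof.
move=> gM; exists M; split; first by rewrite num_real.
by move=> z Mz x _; apply: (le_trans (gM x)); exact: ltW.
Qed.

Lemma integrable_mul_bounded f g (M : R) : mu.-integrable setT (EFin \o f) ->
  measurable_fun setT g -> (forall x, `|g x| <= M) ->
  mu.-integrable setT (EFin \o (fun x => f x * g x)).
Proof.
move=> fi mg gM.
exact: (integrableMl measurableT fi mg (bounded_fun_within setT gM)).
Qed.

Lemma lip_test_integrable_mul X f g : bounded_set X -> lip_test X g ->
  mu.-integrable setT (EFin \o f) ->
  mu.-integrable setT (EFin \o (fun x => f x * g x)).
Proof.
move=> bX gX fi; have [M gM] := lip_test_bounded bX gX.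
by apply: integrable_mul_bounded gM => //; exact: lip_test_measurable gX.
Qed.

Lemma lip_test_integrable X g : open X -> bounded_set X -> lip_test X g ->
  mu.-integrable setT (EFin \o g).
Proof.
move=> oX bX gX; have [M gM] := lip_test_bounded bX gX.
have mX : measurable X by exact: open_measurable_rV.
have gi : mu.-integrable X (EFin \o g).
  apply: measurable_bounded_integrable => //; first exact: bounded_rV_lebesgue_lty.
    by apply: measurable_funTS; exact: lip_test_measurable gX.
  exact: bounded_fun_within gM.
move/integrable_mkcond : gi => /(_ mX); rewrite restrict_EFin.
congr (_.-integrable _ _); apply/funext => x /=; rewrite patchE.
by case: ifPn => // /negP nXx; rewrite gX.1// => Xx; exact/nXx/mem_set.
Qed.

Definition set_dist (C : set V) (x : V) : R := inf [set `|x - c| | c in C].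

Lemma set_dist_le C x c : C c -> set_dist C x <= `|x - c|.
Proof.
move=> Cc; apply: ge_inf; last by exists c.
by exists 0 => _ [b _ <-].
Qed.

Lemma set_dist_ge C x (e : R) : C !=set0 -> (forall c, C c -> e <= `|x - c|) -> e <= set_dist C x.
Proof.
move=> [c0 Cc0] H; apply: lb_le_inf; first by exists `|x - c0|; exists c0.
by move=> _ [c Cc <-]; exact: H.
Qed.

Lemma set_dist_lip C : C !=set0 -> lipschitz_bound (set_dist C) 1.
Proof.
move=> C0.
have H x y : set_dist C x - `|x - y| <= set_dist C y.
  apply: set_dist_ge => // c Cc; rewrite lerBlDr.
  apply: (le_trans (set_dist_le x Cc)); rewrite [leRHS]addrC.
  rewrite -[x - c](subrKA y x (- c)).
  exact: ler_normD.
move=> x y; rewrite mul1r ler_norml.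
have := H x y; have := H y x; rewrite (distrC y x) => h1 h2.
by apply/andP; split; lra.
Qed.

(** Lipschitz functions increasing to the indicator of U, when U is open and not the
    whole space. *)
Definition tent U (n : nat) (x : V) : R := Num.min 1 (n%:R * set_dist (~` U) x).

Lemma minr1_lip (a b : R) : `|Num.min 1 a - Num.min 1 b| <= `|a - b|.
Proof.
wlog ab : a b / a <= b.
  move=> H; have [/H//|/ltW/H] := leP a b.
  by rewrite [X in X <= _ -> _]distrC [X in _ <= X -> _]distrC.
rewrite ler0_norm ?ler0_norm ?subr_le0//; last by rewrite le_min !ge_min lexx ab orbT.
rewrite !opprB; have [b1|b1] := leP 1 b.
  have [a1|a1] := leP 1 a; first by rewrite subrr subr_ge0.
  by rewrite lerB.
by have [a1|a1] := leP 1 a; [lra|].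
Qed.

Lemma tent_ge0 U n x : U != setT -> 0 <= tent U n x <= 1.
Proof.
move=> UT; rewrite /tent le_min ler01 ge_min lexx /= mulr_ge0//.
apply: set_dist_ge => [|c _]; last by [].
by apply/set0P; apply: contra_neq UT => UC0; rewrite -[U]setCK UC0 setC0.
Qed.

Lemma tent_lip_test X U n : U != setT -> U `<=` X -> lip_test X (tent U n).
Proof.
move=> UT UX.
have UC0 : ~` U !=set0.
  by apply/set0P; apply: contra_neq UT => UC0; rewrite -[U]setCK UC0 setC0.
split=> [x nXx|].
  have d0 : set_dist (~` U) x = 0.
    apply/eqP; rewrite eq_le; apply/andP; split; last exact: set_dist_ge.
    by rewrite (le_trans (@set_dist_le (~` U) x x _)) ?subrr ?normr0// => /UX.
  by rewrite /tent d0 mulr0 min_r.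
exists n%:R => x y; apply: (le_trans (minr1_lip _ _)).
rewrite -mulrBr normrM ger0_norm//; apply: ler_wpM2l => //.
by have := set_dist_lip UC0 x y; rewrite mul1r.
Qed.

Lemma tent_cvg U x : open U -> U != setT -> U x -> tent U n x @[n --> \oo] --> (1 : R).
Proof.
move=> oU UT Ux.
have [e /= e0 eU] : nbhs_ball x U by rewrite nbhs_ballE; exact: oU.
have de : e <= set_dist (~` U) x.
  apply: set_dist_ge => [|c nUc].
    by apply/set0P; apply: contra_neq UT => UC0; rewrite -[U]setCK UC0 setC0.
  rewrite leNgt; apply/negP => xc; apply: nUc; apply: eU.
  by rewrite -ball_normE.
apply: cvg_near_cst; near=> n; rewrite /tent min_l//.
apply: (@le_trans _ _ (n%:R * e)); last by apply: ler_wpM2l.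
rewrite -ler_pdivrMr// div1r.
by near: n; exact: nbhs_infty_ger.
Unshelve. all: by end_near. Qed.

(** Dominated convergence along the tents of U. *)
Lemma open_integral_eq0 X f U : bounded_set X -> U != setT -> open U -> U `<=` X ->
  mu.-integrable setT (EFin \o f) ->
  (forall h, lip_test X h -> \int[mu]_x (f x * h x) = 0) ->
  (\int[mu]_(x in U) (f x)%:E = 0)%E.
Proof.
move=> bX UT oU UX fi fh.
have mU : measurable U by exact: open_measurable_rV.
have mf : measurable_fun setT f by apply/measurable_EFinP; exact: measurable_int fi.
pose F n x := (f x * tent U n x)%:E.
have Fi n : mu.-integrable setT (F n).
  by apply: (lip_test_integrable_mul bX) => //; exact: tent_lip_test.
have [|||||_ _] := @dominated_convergence _ _ _ mu setT measurableT F
  (EFin \o (f \_ U)) (fun x => `|(f x)%:E|%E).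
- by move=> n; exact: measurable_int (Fi n).
- by apply/measurable_EFinP; apply/(measurable_restrictT _ mU); exact: measurable_funTS mf.
- apply: aeW => x _ /=; rewrite /F patchE; case: ifPn => [/set_mem Ux|nUx].
    apply: cvg_EFin; first by near=> n.
    rewrite -[X in _ --> X]mulr1; apply: cvgMr; exact: tent_cvg.
  rewrite [X in X @ _ --> _](_ : _ = cst 0%E); first exact: cvg_cst.
  apply/funext => n /=; rewrite (tent_lip_test n UT (@subset_refl _ U)).1 ?mulr0//.
  by move=> Ux; move/negP: nUx; apply; exact/mem_set.
- exact: integrable_abse.
- apply: aeW => x n _; rewrite /F lee_fin normrM.
  have /andP[t0 t1] := tent_ge0 n x UT.
  by rewrite (ger0_norm t0) ler_piMr.
rewrite (_ : (fun n => _) = cst 0%E); last first.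
  apply/funext => n /=.
  have ifin : (\int[mu]_x F n x)%E \is a fin_num by exact: integrable_fin_num (Fi n).
  by rewrite -(fineK ifin); congr (_%:E); exact: fh (tent_lip_test n UT UX).
move=> /(cvg_lim (@ereal_hausdorff R)); rewrite lim_cst => [H|]; last exact: ereal_hausdorff.
by rewrite integral_mkcond restrict_EFin -H.
Unshelve. all: by end_near. Qed.

(** The integral over X `&` S vanishes for every open S by the previous lemma, hence for
    every measurable S since the open sets are closed under intersection. *)
Lemma lip_test_ae_eq0 X f : open X -> bounded_set X -> X != setT ->
  mu.-integrable setT (EFin \o f) ->
  (forall h, lip_test X h -> \int[mu]_x (f x * h x) = 0) ->
  ae_eq mu X f (fun=> 0).
Proof.
move=> oX bX XT fi fh.
have mX : measurable X by exact: open_measurable_rV.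
have fiS S : measurable S -> mu.-integrable S (EFin \o f).
  by move=> mS; exact: integrableS fi.
have H : forall S, <<s [set U : set V | open U] >> S -> (\int[mu]_(x in X `&` S) (f x)%:E = 0)%E.
  apply: (@dynkin_induction _ V [set U : set V | open U]
    (fun S => (\int[mu]_(x in X `&` S) (f x)%:E = 0)%E)).
  - exact: measurable_rVE.
  - by move=> A B; exact: openI.
  - by rewrite setIT; exact: (open_integral_eq0 bX).
  - move=> A oA; apply: (open_integral_eq0 bX) => //; last exact: openI.
    by apply: contra_neq XT => XAT; rewrite -subTset -XAT.
  - move=> S mS S0.
    have := open_integral_eq0 bX XT oX (@subset_refl _ X) fi fh.
    rewrite -{1}(setIT X) -(setUv S) setIUr integral_setU//=.
    + by rewrite S0 add0e.
    + exact: measurableI.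
    + by apply: measurableI => //; exact: measurableC.
    + apply: measurable_int; apply: fiS; apply: measurableU; apply: measurableI => //.
      exact: measurableC.
    + by rewrite disj_set2E setIACA setICr setI0.
  - move=> F mF tF F0; rewrite setI_bigcupr integral_bigcup//.
    + by rewrite eseries0// => i _ _; rewrite F0.
    + by apply: trivIset_setIl.
    + by move=> k; exact: measurableI.
    + by apply: fiS; apply: bigcupT_measurable => k; exact: measurableI.
have : ae_eq mu X (EFin \o f) (cst 0%E).
  apply: integral_ae_eq => //; first exact: fiS.
  move=> E EX mE; rewrite integral0.
  rewrite -(setIidr EX); apply: H; rewrite -measurable_rVE //.
by apply: filterS => x /[apply] /= -[].
Qed.

End test_functions.

(** * Correlation with a real integrable function *)

Lemma bounded_rV_neq_setT (R : realType) (d : nat) (X : set 'rV[R]_d) :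
  (0 < d)%N -> bounded_set X -> X != setT.
Proof.
move=> d0 /bounded_subset_ball[M M0 XM]; apply/eqP => XT.
have : X (const_mx M) by rewrite XT.
move=> /XM; rewrite rV_ballE//= => /(_ (Ordinal d0)); rewrite !mxE subr0.
by rewrite gtr0_norm// ltxx.
Qed.

Section linear_combinations.
Context {R : realType} {d : nat}.
Local Notation V := 'rV[R]_d.
Local Notation mu := (@rV_lebesgue R d).
Variable D : set V.
Hypothesis mD : measurable D.
Variables (n : nat) (c : 'I_n -> R) (F : 'I_n -> V -> R).

Lemma integrable_lincomb : (forall i, mu.-integrable D (EFin \o F i)) ->
  mu.-integrable D (EFin \o (fun x => \sum_(i < n) c i * F i x)).
Proof.
move=> iF; have icF i : mu.-integrable D (EFin \o (fun x => c i * F i x)).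
  by have := integrableZl mD (c i) (iF i); apply: eq_integrable.
have := @integrable_sum _ _ _ mu D mD _ (index_enum 'I_n) xpredT _ (fun i _ => icF i).
by apply: eq_integrable => // x _ /=; rewrite -sumEFin.
Qed.

Lemma Rintegral_lincomb : (forall i, mu.-integrable D (EFin \o F i)) ->
  \int[mu]_(x in D) (\sum_(i < n) c i * F i x) =
  \sum_(i < n) c i * \int[mu]_(x in D) F i x.
Proof.
move=> iF; rewrite /Rintegral; under eq_integral do rewrite -sumEFin.
have icF i : mu.-integrable D (fun x => (c i * F i x)%:E).
  by have := integrableZl mD (c i) (iF i); apply: eq_integrable.
rewrite integral_sum// -sum_fine => [|i _]; last exact: integrable_fin_num (icF i).
by apply: eq_bigr => i _; rewrite -RintegralZl.
Qed.

Lemma continuous_lincomb :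
  (forall i, continuous (F i)) -> continuous (fun x => \sum_(i < n) c i * F i x).
Proof.
elim: n c F => [|m IH] a f cf.
  rewrite (_ : (fun _ => _) = (fun=> 0)); first exact: cst_continuous.
  by apply/funext => x; rewrite big_ord0.
under eq_fun do rewrite big_ord_recl.
move=> x; apply: (@cvgD _ R^o _ (nbhs x)).
  by apply: (@cvgMl_tmp _ _ (nbhs x)); exact: cf.
by apply: (IH (fun i => a (lift ord0 i)) (fun i => f (lift ord0 i))) => i; exact: cf.
Qed.

End linear_combinations.

Section correlation.
Context {R : realType} {d : nat}.
Local Notation V := 'rV[R]_d.
Local Notation mu := (@rV_lebesgue R d).
Variables (X : set V).
Hypotheses (oX : open X) (bX : bounded_set X).
Local Notation N := (lip_test X).

Definition correlation (phi g : V -> R) (x : V) : R := \int[mu]_y (phi (x + y) * g y).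

Definition pairing (u g : V -> R) : R := \int[mu]_x (u x * g x).

Section phi.
Variable phi : V -> R.
Hypothesis iphi : mu.-integrable setT (EFin \o phi).
Local Notation G := (correlation phi).
Local Notation B g h := (pairing (G g) h).

Let mphi : measurable_fun setT phi.
Proof. by apply/measurable_EFinP; exact: measurable_int iphi. Qed.

Lemma correlation_integrable g x : N g ->
  mu.-integrable setT (EFin \o (fun y => phi (x + y) * g y)).
Proof.
move=> Ng; apply: (lip_test_integrable_mul bX Ng (f := fun y => phi (x + y))).
exact: integrable_rV_translation.
Qed.

Lemma correlationE g x : N g -> G g x = \int[mu]_z (phi z * g (z - x)).
Proof.
move=> Ng.
rewrite -(@Rintegral_rV_translation _ _ x); last first.
  have := integrable_rV_translation (- x) (correlation_integrable x Ng).
  rewrite /comp; under eq_fun do rewrite addrA subrr add0r addrC.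
  under eq_fun do rewrite [X in g X]addrC.
  by under eq_fun do rewrite mulrC [X in g X]addrC.
by apply: eq_Rintegral => y _; rewrite [x + y - x]addrAC subrr add0r.
Qed.

Lemma correlation_bounded g : N g -> exists M, forall x, `|G g x| <= M.
Proof.
move=> Ng; have [M gM] := lip_test_bounded bX Ng.
exists (M * \int[mu]_x `|phi x|) => x.
have ix := correlation_integrable x Ng.
have iphix := integrable_rV_translation x iphi.
apply: (le_trans (le_normr_Rintegral measurableT ix)).
rewrite -(Rintegral_rV_translation x (integrable_norm iphi)) -RintegralZl//; last first.
  exact: integrable_norm iphix.
apply: le_Rintegral => //.
- exact: integrable_norm ix.
- have := integrableZl measurableT M (integrable_norm iphix).
  by apply: eq_integrable.
- by move=> y _; rewrite normrM mulrC ler_wpM2r.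
Qed.

(** After the change of variables z = x + y the variable x only occurs in the Lipschitz
    factor. *)
Lemma correlation_lipschitz g : N g -> exists L, lipschitz_bound (G g) L.
Proof.
move=> Ng; have [gX [L gL]] := Ng.
exists (L * \int[mu]_x `|phi x|) => x x'.
have igt t : mu.-integrable setT (EFin \o (fun z => phi z * g (z - t))).
  have [M gM] := lip_test_bounded bX Ng.
  apply: (integrable_mul_bounded (M := M)) => //.
  have := measurableT_comp (lip_test_measurable Ng) (measurable_rV_translation (- t)).
  by rewrite /comp; under eq_fun do rewrite addrC.
rewrite !(correlationE _ Ng) -RintegralB//.
apply: (le_trans (le_normr_Rintegral _ _)) => //.
  have := integrableB measurableT (igt x) (igt x').
  by apply: eq_integrable => // z _ /=; rewrite EFinB.
rewrite mulrAC -RintegralZl//; last exact: integrable_norm iphi.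
apply: le_Rintegral => //.
- have := integrableB measurableT (igt x) (igt x').
  by move=> /integrable_abse; apply: eq_integrable.
- have := integrableZl measurableT (L * `|x - x'|) (integrable_norm iphi).
  by apply: eq_integrable.
- move=> z _; rewrite -mulrBr normrM mulrC ler_wpM2r//.
  by apply: (le_trans (gL _ _)); rewrite opprB addrC addrA subrK distrC.
Qed.

Lemma correlation_continuous g : N g -> continuous (G g).
Proof. by move=> /correlation_lipschitz[L]; exact: lipschitz_bound_continuous. Qed.

Lemma correlationD g h x : N g -> N h -> G (fun y => g y + h y) x = G g x + G h x.
Proof.
move=> Ng Nh; rewrite /correlation -RintegralD//; try exact: correlation_integrable.
by apply: eq_Rintegral => y _; rewrite mulrDr.
Qed.

Lemma correlationZ a g x : N g -> G (fun y => a * g y) x = a * G g x.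
Proof.
move=> Ng; rewrite /correlation -RintegralZl//; last exact: correlation_integrable.
by apply: eq_Rintegral => y _; rewrite mulrCA.
Qed.

Lemma correlation_integrable_mul g h : N g -> N h ->
  mu.-integrable setT (EFin \o (fun x => G g x * h x)).
Proof.
move=> Ng Nh; have [M GM] := correlation_bounded Ng.
have := integrable_mul_bounded (lip_test_integrable oX bX Nh)
  (continuous_measurable_rV (correlation_continuous Ng)) GM.
by apply: eq_integrable => // x _ /=; rewrite mulrC.
Qed.

Lemma pairingDl g g' h : N g -> N g' -> N h ->
  B (fun x => g x + g' x) h = B g h + B g' h.
Proof.
move=> Ng Ng' Nh; rewrite /pairing -RintegralD//; try exact: correlation_integrable_mul.
by apply: eq_Rintegral => y _; rewrite correlationD// mulrDl.
Qed.

Lemma pairingZl a g h : N g -> N h -> B (fun x => a * g x) h = a * B g h.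
Proof.
move=> Ng Nh; rewrite /pairing -RintegralZl//; last exact: correlation_integrable_mul.
by apply: eq_Rintegral => y _; rewrite correlationZ// mulrA.
Qed.

Lemma measurable_rV_add : measurable_fun setT (fun z : V * V => z.1 + z.2).
Proof.
apply/measurable_fun_rVP => i.
rewrite (_ : _ \o _ = (fun z : V * V => rV_coord i z.1 + rV_coord i z.2)).
  by apply: measurable_funD; apply: measurableT_comp (measurable_rV_coord i) _.
by apply/funext => z; rewrite /rV_coord /= mxE.
Qed.

(** Fubini for phi (x + y) * g y * h x, whose integrability only uses that g is bounded
    and that phi and h are integrable. *)
Lemma pairingC g h : N g -> N h -> B g h = B h g.
Proof.
move=> Ng Nh.
pose F (z : V * V) : R := phi (z.1 + z.2) * g z.2 * h z.1.
have mF : measurable_fun setT F.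
  apply: measurable_funM; first apply: measurable_funM.
  - exact: measurableT_comp mphi measurable_rV_add.
  - by apply: measurableT_comp => //; exact: lip_test_measurable Ng.
  - by apply: measurableT_comp => //; exact: lip_test_measurable Nh.
have [M gM] := lip_test_bounded bX Ng.
have M0 : 0 <= M by exact: le_trans (gM 0).
have iF : (mu \x mu)%E.-integrable setT (EFin \o F).
  apply/integrable12ltyP; first exact/measurable_EFinP.
  have ih := lip_test_integrable oX bX Nh.
  pose c := M * \int[mu]_x `|phi x|.
  apply: (@le_lt_trans _ _ (\int[mu]_x (c%:E * `|(h x)%:E|))%E); last first.
    have := integrableZl measurableT c (integrable_abse ih).
    by move=> /integrable_lty; apply.
  apply: ge0_le_integral => //.
  - by move=> x _; exact: integral_ge0.
  - apply: (@measurable_fun_fubini_tonelli_F _ _ _ _ _ mu (fun z => `|(EFin \o F) z|%E)) => //.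
    by apply: measurableT_comp => //; exact/measurable_EFinP.
  - by apply: measurable_int; exact: (integrableZl measurableT c (integrable_abse ih)).
  - move=> x _.
    have iphix := integrable_rV_translation x iphi.
    have E : (\int[mu]_y `|(phi (x + y)%R)%:E| = (\int[mu]_y `|phi y|)%:E)%E.
      rewrite -(Rintegral_rV_translation x (integrable_norm iphi)) /Rintegral fineK//.
      exact: integrable_fin_num (integrable_norm iphix).
    apply: (@le_trans _ _ (\int[mu]_y ((M * `|h x|)%:E * `|(phi (x + y)%R)%:E|))%E); last first.
      rewrite integralZl//; last exact: integrable_abse iphix.
      by rewrite E /c -EFinM lee_fin mulrAC.
    apply: ge0_le_integral => //.
    + apply: measurableT_comp => //; apply/measurable_EFinP.
      exact: measurableT_comp mF (pair1_measurable x).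
    + apply: emeasurable_funM => //.
      by apply: measurableT_comp => //; exact: measurable_int iphix.
    + move=> y _; rewrite /F /= -EFinM lee_fin !normrM.
      rewrite (_ : _ * _ * _ = `|g y| * (`|h x| * `|phi (x + y)|)); last by ring.
      by rewrite -[leRHS]mulrA ler_wpM2r// mulr_ge0.
rewrite /pairing /correlation.
have L x : (\int[mu]_y (F (x, y))%:E)%E = ((\int[mu]_y (phi (x + y) * g y)) * h x)%:E.
  have ix := correlation_integrable x Ng.
  rewrite -RintegralZr// /Rintegral fineK//.
  by have := integrable_fin_num measurableT (integrableZr measurableT (h x) ix).
have L' y : (\int[mu]_x (F (x, y))%:E)%E = ((\int[mu]_x (phi (y + x) * h x)) * g y)%:E.
  have ix := correlation_integrable y Nh.
  rewrite -RintegralZr// /Rintegral fineK//.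
    by apply: eq_integral => x _; rewrite /F/= mulrAC addrC.
  by have := integrable_fin_num measurableT (integrableZr measurableT (g y) ix).
rewrite /Rintegral; congr fine.
under eq_integral do rewrite -L.
under [RHS]eq_integral do rewrite -L'.
exact: (Fubini iF).
Qed.

End phi.
End correlation.

(** * Orthonormal families and separation of variables *)

Section orthonormal_family.
Context {R : realType} {T : Type}.
Variables (N : (T -> R) -> Prop) (B : (T -> R) -> (T -> R) -> R).
Hypothesis N0 : N (fun=> 0).
Hypothesis ND : forall g h, N g -> N h -> N (fun x => g x + h x).
Hypothesis NZ : forall a g, N g -> N (fun x => a * g x).
Hypothesis BC : forall g h, N g -> N h -> B g h = B h g.
Hypothesis BDl : forall g g' h, N g -> N g' -> N h -> B (fun x => g x + g' x) h = B g h + B g' h.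
Hypothesis BZl : forall a g h, N g -> N h -> B (fun x => a * g x) h = a * B g h.
Hypothesis B_ge0 : forall g, N g -> 0 <= B g g.

Let N_sum n (c : 'I_n -> R) (g : 'I_n -> T -> R) :
  (forall i, N (g i)) -> N (fun x => \sum_(i < n) c i * g i x).
Proof.
elim: n c g => [|n IH] c g Ng.
  by rewrite (_ : (fun _ => _) = (fun=> 0))//; apply/funext => x; rewrite big_ord0.
under eq_fun do rewrite big_ord_recl.
by apply: ND; [exact: NZ|exact: IH].
Qed.

Lemma form_suml n (c : 'I_n -> R) (g : 'I_n -> T -> R) h :
  (forall i, N (g i)) -> N h ->
  B (fun x => \sum_(i < n) c i * g i x) h = \sum_(i < n) c i * B (g i) h.
Proof.
move=> + Nh; elim: n c g => [|n IH] c g Ng.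
  rewrite big_ord0 (_ : (fun _ => _) = (fun x => 0 * (fun=> 0) x)); last first.
    by apply/funext => x; rewrite big_ord0 mul0r.
  by rewrite BZl// mul0r.
under eq_fun do rewrite big_ord_recl.
rewrite BDl//; [|exact: NZ|by apply: N_sum].
by rewrite (IH (fun i => c (lift ord0 i)))// BZl// big_ord_recl.
Qed.

(** Otherwise B (h + t g) (h + t g) = B h h + 2 t B g h is negative for some t. *)
Lemma form_isotropic g h : N g -> N h -> B g g = 0 -> B g h = 0.
Proof.
move=> Ng Nh g0; apply/eqP; apply: contrapT => /negP gh0.
pose t := - (B h h + 1) / (2 * B g h).
have := B_ge0 (ND Nh (NZ t Ng)).
have BDr : B (fun x => h x + t * g x) (fun x => h x + t * g x) = B h h + 2 * t * B g h.
  have Ntg := NZ t Ng.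
  rewrite BDl ?BZl//; try exact: ND.
  rewrite (BC Nh (ND Nh Ntg)) (BC Ng (ND Nh Ntg)) !BDl// !BZl// g0 (BC Nh Ng).
  by ring.
rewrite BDr (_ : 2 * t * B g h = - (B h h + 1)); last by rewrite /t; field.
lra.
Qed.

Definition orthonormal_for n (g : 'I_n -> T -> R) :=
  (forall i, N (g i)) /\ (forall i j, B (g i) (g j) = (i == j)%:R).

Lemma orthonormal_residual n (g : 'I_n -> T -> R) a : orthonormal_for g -> N a ->
  let r := fun x => a x + \sum_(i < n) - B (g i) a * g i x in
  [/\ N r, forall i, B (g i) r = 0 & B r r = B r a].
Proof.
move=> [Ng gg] Na r.
have Ns : N (fun x => \sum_(i < n) - B (g i) a * g i x) by exact: N_sum.
have Nr : N r by exact: ND.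
have gr i : B (g i) r = 0.
  rewrite BC// BDl// form_suml// (bigD1 i)//= gg eqxx mulr1 big1 => [|j ji].
    by rewrite addr0 (BC (Ng i) Na) subrr.
  by rewrite gg (negPf ji) mulr0.
split => //.
rewrite {2}/r BC// BDl// form_suml// big1 ?addr0; first exact: BC.
by move=> i _; rewrite gr mulr0.
Qed.

Lemma orthonormal_extend n (g : 'I_n -> T -> R) a : orthonormal_for g -> N a ->
  (forall i, B (g i) a = 0) -> 0 < B a a -> exists g' : 'I_n.+1 -> T -> R, orthonormal_for g'.
Proof.
move=> [Ng gg] Na ga aa.
pose s := (Num.sqrt (B a a))^-1; pose e := fun x => s * a x.
have Ne : N e by exact: NZ.
have ee : B e e = 1.
  rewrite BZl// BC// BZl// mulrA -invfM -expr2 sqr_sqrtr ?ltW// mulVf// gt_eqF//.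
have eg i : B e (g i) = 0 by rewrite BZl// BC// ga mulr0.
exists (fun i => if unlift ord0 i is Some j then g j else e).
split=> [i|i j]; first by case: unliftP.
case: (unliftP ord0 i) => [i'|] ->; case: (unliftP ord0 j) => [j'|] ->.
- by rewrite gg (inj_eq lift_inj).
- by rewrite BC// eg.
- by rewrite eg.
- by rewrite ee eqxx.
Qed.

(** The residual of a with respect to an orthonormal family of maximal size is isotropic,
    as otherwise it could be normalized and added to the family; an isotropic vector is orthogonal
    to everything. *)
Lemma maximal_orthonormal K :
  (forall n (g : 'I_n -> T -> R), orthonormal_for g -> (n <= K)%N) ->
  exists n (g : 'I_n -> T -> R), orthonormal_for g /\
    forall a b, N a -> N b -> B a b = \sum_(i < n) B (g i) a * B (g i) b.
Proof.
move=> bound.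
pose P n := `[< exists g : 'I_n -> T -> R, orthonormal_for g >].
have P0 : exists n, P n.
  exists 0%N; apply/asboolP; exists (fun _ _ => 0); split; [by case|by case].
have PK n : P n -> (n <= K)%N by move=> /asboolP[g]; exact: bound.
case: (ex_maxnP P0 PK) => n /asboolP[g og] nmax.
exists n, g; split => // a b Na Nb.
have [Nr gr rr] := orthonormal_residual og Na.
set r := (fun x => _) in Nr gr rr.
have r0 : B r r = 0.
  apply/eqP; rewrite eq_le B_ge0// andbT leNgt; apply/negP => rr0.
  have [g' og'] := orthonormal_extend og Nr gr rr0.
  by have := nmax n.+1; rewrite ltnn => H; suff : false by []; apply: H; apply/asboolP; exists g'.
have := form_isotropic Nr Nb r0.
have [Ng _] := og.
rewrite /r BDl//; last exact: N_sum.
rewrite form_suml// => /eqP; rewrite addr_eq0 => /eqP ->.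
by rewrite -sumrN; apply: eq_bigr => i _; rewrite mulNr opprK.
Qed.

End orthonormal_family.

Section separated_kernel.
Context {R : realType} {d : nat}.
Local Notation V := 'rV[R]_d.
Local Notation mu := (@rV_lebesgue R d).
Variables (X : set V).
Hypotheses (oX : open X) (bX : bounded_set X) (XT : X != setT).
Local Notation N := (lip_test X).
Variable phi : V -> R.
Hypothesis iphi : mu.-integrable setT (EFin \o phi).
Local Notation G := (correlation phi).

Let mX : measurable X. Proof. exact: open_measurable_rV. Qed.

Lemma bounded_restrict_integrable (u : V -> R) (M : R) :
  continuous u -> (forall x, `|u x| <= M) -> mu.-integrable setT (EFin \o (u \_ X)).
Proof.
move=> cu uM; have ui : mu.-integrable X (EFin \o u).
  apply: measurable_bounded_integrable => //; first exact: bounded_rV_lebesgue_lty.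
    by apply: measurable_funTS; exact: continuous_measurable_rV.
  exact: bounded_fun_within uM.
by move/integrable_mkcond : ui => /(_ mX); rewrite restrict_EFin.
Qed.

Lemma lip_test_restrict (u g : V -> R) x : N g -> (u \_ X) x * g x = u x * g x.
Proof.
move=> Ng; rewrite patchE; case: ifPn => // /negP nXx.
by rewrite Ng.1 ?mulr0// => Xx; exact/nXx/mem_set.
Qed.

(** Testing the identity of forms against b gives the correlation of a at every point of
    X, both sides being continuous; testing this against a gives the kernel itself, but
    only almost everywhere, since phi need not be continuous. *)
Lemma separated_kernel n (u : 'I_n -> V -> R) (M : 'I_n -> R) :
  (forall i, continuous (u i)) -> (forall i x, `|u i x| <= M i) ->
  (forall a b, N a -> N b -> pairing (G a) b = \sum_(i < n) pairing (u i) a * pairing (u i) b) ->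
  forall x, X x -> ae_eq mu X (fun y => phi (x + y)) (fun y => \sum_(i < n) u i x * u i y).
Proof.
move=> cu uM H.
have iu i : mu.-integrable setT (EFin \o (u i \_ X)) by exact: bounded_restrict_integrable.
have pu i a : N a -> pairing (u i) a = \int[mu]_x ((u i \_ X) x * a x).
  by move=> Na; apply: eq_Rintegral => x _; rewrite lip_test_restrict.
have isum (c : 'I_n -> R) :
    mu.-integrable setT (EFin \o (fun x => \sum_(i < n) c i * (u i \_ X) x)).
  exact: integrable_lincomb.
have intsum (c : 'I_n -> R) b : N b ->
    \int[mu]_x ((\sum_(i < n) c i * (u i \_ X) x) * b x) = \sum_(i < n) c i * pairing (u i) b.
  move=> Nb.
  have ib i := lip_test_integrable_mul bX Nb (iu i).
  under eq_Rintegral do rewrite mulr_suml.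
  under eq_Rintegral do under eq_bigr do rewrite -mulrA.
  by rewrite Rintegral_lincomb//; apply: eq_bigr => i _; rewrite pu.
have Gsep a : N a -> forall x, X x -> G a x = \sum_(i < n) pairing (u i) a * u i x.
  move=> Na x Xx.
  have cG := correlation_continuous bX iphi Na.
  have [MG GM] := correlation_bounded bX iphi Na.
  have iG := bounded_restrict_integrable cG GM.
  have sE z : X z -> \sum_(i < n) pairing (u i) a * (u i \_ X) z =
      \sum_(i < n) pairing (u i) a * u i z.
    by move=> Xz; apply: eq_bigr => i _; rewrite patchE mem_set.
  pose f z := (G a \_ X) z - \sum_(i < n) pairing (u i) a * (u i \_ X) z.
  have if_ : mu.-integrable setT (EFin \o f).
    have := integrableB measurableT iG (isum (fun i => pairing (u i) a)).
    by apply: eq_integrable.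
  have f0 : forall b, N b -> \int[mu]_z (f z * b z) = 0.
    move=> b Nb; have := H a b Na Nb.
    rewrite -(intsum (fun i => pairing (u i) a))// => Hab.
    transitivity (\int[mu]_z ((G a \_ X) z * b z -
        (\sum_(i < n) pairing (u i) a * (u i \_ X) z) * b z)).
      by apply: eq_Rintegral => z _; rewrite mulrBl.
    rewrite RintegralB//; first last.
    - by apply: (lip_test_integrable_mul bX Nb (isum _)).
    - by apply: (lip_test_integrable_mul bX Nb iG).
    rewrite -Hab; apply/eqP; rewrite subr_eq0; apply/eqP.
    by apply: eq_Rintegral => z _; rewrite lip_test_restrict.
  have f_ae := lip_test_ae_eq0 oX bX XT if_ f0.
  have csum : continuous (fun z => \sum_(i < n) pairing (u i) a * u i z).
    exact: continuous_lincomb.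
  apply: (@ae_eq_open_eq _ _ X (G a) (fun z => \sum_(i < n) pairing (u i) a * u i z)) => //.
  - by move=> ? _; exact: cG.
  - by move=> ? _; exact: csum.
  apply: filterS f_ae => z H' Xz; have := H' Xz; rewrite /f /= => /eqP; rewrite subr_eq0 => /eqP.
  by rewrite sE// patchE mem_set.
move=> x Xx.
have iphix := integrable_rV_translation x iphi.
pose f y := phi (x + y) - \sum_(i < n) u i x * (u i \_ X) y.
have if_ : mu.-integrable setT (EFin \o f).
  have := integrableB measurableT iphix (isum (fun i => u i x)).
  by apply: eq_integrable.
have f0 : forall b, N b -> \int[mu]_z (f z * b z) = 0.
  move=> b Nb.
  transitivity (\int[mu]_z (phi (x + z) * b z - (\sum_(i < n) u i x * (u i \_ X) z) * b z)).
    by apply: eq_Rintegral => z _; rewrite mulrBl.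
  rewrite RintegralB//; first last.
  - by apply: (lip_test_integrable_mul bX Nb (isum _)).
  - exact: (correlation_integrable bX iphi x Nb).
  rewrite intsum// -/(correlation phi b x) Gsep//; apply/eqP; rewrite subr_eq0; apply/eqP.
  by apply: eq_bigr => i _; rewrite mulrC.
have f_ae := lip_test_ae_eq0 oX bX XT if_ f0.
apply: filterS f_ae => z H' Xz; have := H' Xz; rewrite /f /= => /eqP; rewrite subr_eq0 => /eqP ->.
by apply: eq_bigr => i _; rewrite patchE mem_set.
Qed.

End separated_kernel.

(** * Bases of families of vectors, simultaneous diagonalization *)

Section vector_families.
Context {F : fieldType} {N : nat} {I : Type}.
Variable w : I -> 'rV[F]_N.

Definition rows_of m (y : 'I_m -> I) : 'M[F]_(m, N) := \matrix_(i < m) w (y i).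

Lemma row_rows_of m (y : 'I_m -> I) i : row i (rows_of y) = w (y i).
Proof. by rewrite rowK. Qed.

Lemma row_free_extend m (y : 'I_m -> I) x :
  row_free (rows_of y) -> ~~ (w x <= rows_of y)%MS ->
  row_free (rows_of (fun i : 'I_m.+1 => if unlift ord0 i is Some j then y j else x)).
Proof.
move=> yfree xy; set y' := fun i => _.
apply: inj_row_free => a; rewrite mulmx_sum_row big_ord_recl row_rows_of /y' unlift_none.
under eq_bigr do rewrite row_rows_of liftK.
pose b := \row_j a 0 (lift ord0 j).
have -> : \sum_(i < m) a 0 (lift ord0 i) *: w (y i) = b *m rows_of y.
  by rewrite mulmx_sum_row; apply: eq_bigr => i _; rewrite row_rows_of mxE.
move=> /eqP; rewrite addr_eq0 => /eqP axb.
have a0 : a 0 ord0 = 0.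
  apply: contraNeq xy => a0; rewrite -(scalerK a0 (w x)) axb.
  by rewrite scalerN -scaleNr scalemx_sub// submxMl.
move: axb; rewrite a0 scale0r => /esym/eqP; rewrite oppr_eq0 mulmx_free_eq0// => /eqP b0.
apply/rowP => i; rewrite !mxE; case: (unliftP ord0 i) => [j|] -> //.
by move/rowP : b0 => /(_ j); rewrite !mxE.
Qed.

(** The family is arbitrary, possibly infinite: a basis of its span is extracted by taking
    an independent subfamily of maximal size. *)
Lemma family_basis (S : set I) : exists m (y : 'I_m -> I),
  [/\ forall i, S (y i), row_free (rows_of y) & forall x, S x -> (w x <= rows_of y)%MS].
Proof.
pose P m := `[< exists2 y : 'I_m -> I, (forall i, S (y i)) & row_free (rows_of y) >].
have P0 : exists m, P m.
  exists 0%N; apply/asboolP; exists (fun i : 'I_0 => match notF (ltn_ord i) with end).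
    by case.
  by rewrite /row_free mxrank_eq0 flatmx0.
have PN m : P m -> (m <= N)%N by move=> /asboolP[y _ /eqP <-]; exact: rank_leq_col.
case: (ex_maxnP P0 PN) => m /asboolP[y Sy yfree] mmax.
exists m, y; split => // x Sx; apply: contraT => xy.
have := mmax m.+1; rewrite ltnn; apply; apply/asboolP.
exists (fun i : 'I_m.+1 => if unlift ord0 i is Some j then y j else x); last exact: row_free_extend.
by move=> i; case: unliftP.
Qed.

End vector_families.

Section codiagonalization.
Local Open Scope sesquilinear_scope.
Context {C : numClosedFieldType} {n : nat}.

(** A finite subfamily spans S; it can be trigonalized by a unitary matrix, and a
    triangular Hermitian matrix is diagonal. *)
Lemma hermitian_codiagonalization (S : set 'M[C]_n) :
  (forall A, S A -> A ^t* = A) ->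
  (forall A B, S A -> S B -> A *m B = B *m A) ->
  exists2 P : 'M[C]_n, P \is unitarymx & forall A, S A -> is_diag_mx (P *m A *m P ^t* ).
Proof.
move=> Sherm Scomm.
have [m [y [Sy _ yspan]]] := family_basis (fun A : 'M[C]_n => mxvec A) S.
have [] := @cotrigonalization C n [seq y i | i <- enum 'I_m].
  by move=> _ _ /mapP[i _ ->] /mapP[j _ ->]; exact: Scomm.
move=> P Pu /allP trig; exists P => // A SA.
have diagy i : is_diag_mx (P *m y i *m P^t* ).
  have /is_trig_mxP trigi : is_trig_mx (P *m y i *m P^t* ).
    have := trig (y i) (map_f _ (mem_enum 'I_m i)).
    by rewrite /similar_to /= conjymx.
  apply/is_diag_mxP => j k jk.
  have [/trigi//|kj|/val_inj jk'] := ltngtP j k; last by rewrite jk' eqxx in jk.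
  have : (P *m y i *m P^t* )^t* = P *m y i *m P^t*.
    rewrite !trmx_mul !map_mxM trmxCK (Sherm _ (Sy i)). by rewrite mulmxA.
  move=> /matrixP/(_ j k) <-; rewrite !mxE.
  by have := trigi _ _ kj; rewrite !mxE => ->; rewrite conjC0.
have /submxP[D AD] := yspan A SA.
have -> : A = \sum_i D 0 i *: y i.
  rewrite -[LHS]mxvecK AD mulmx_sum_row linear_sum; apply: eq_bigr => i _.
  by rewrite linearZ /= row_rows_of mxvecK.
rewrite mulmx_sumr mulmx_suml.
apply/is_diag_mxP => j k jk; rewrite summxE big1// => i _.
by rewrite -scalemxAr -scalemxAl mxE (elimT is_diag_mxP (diagy i))// mulr0.
Qed.

End codiagonalization.

(** * Connectedness and local additivity *)

Section connected_induction.
Context {R : realType} {d : nat}.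
Local Notation V := 'rV[R]_d.

Lemma open_norm_ball (X : set V) x : open X -> X x ->
  exists2 r, 0 < r & forall y, `|y - x| < r -> X y.
Proof.
move=> oX Xx.
have [r /= r0 rX] : nbhs_ball x X by rewrite nbhs_ballE; exact: oX.
by exists r => // y yx; apply: rX; rewrite -ball_normE /ball_/= distrC.
Qed.

(** The points of X with the property P form a nonempty relatively clopen subset of X. *)
Lemma connected_ind (X : set V) (P : V -> Prop) : connected X ->
  (exists2 x, X x & P x) ->
  (forall x, X x -> P x -> exists2 r, 0 < r & forall y, `|y - x| < r -> X y -> P y) ->
  (forall x, X x -> (forall r, 0 < r -> exists y, [/\ `|y - x| < r, X y & P y]) -> P x) ->
  forall x, X x -> P x.
Proof.
move=> cX [x0 Xx0 Px0] Popen Pclosed x Xx.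
pose B := [set x | X x /\ P x].
suff : B = X by move=> BX; have : B x; [rewrite BX|case].
apply: cX; first by exists x0.
- exists (interior [set y | X y -> P y]); first exact: open_interior.
  apply/seteqP; split => y.
    move=> [Xy Py]; split => //; have [r r0 rP] := Popen y Xy Py.
    apply/nbhs_ballP; exists r => //= z yz Xz; apply: rP => //.
    by move: yz; rewrite -ball_normE /ball_/= distrC.
  by move=> [Xy /interior_subset]; move=> /(_ Xy).
- exists (closure B); first exact: closed_closure.
  apply/seteqP; split => y; first by move=> By; split; [exact: By.1|exact: subset_closure].
  move=> [Xy clB]; split => //; apply: Pclosed => // r r0.
  have /clB[z [[Xz Pz] yz]] : nbhs y (ball y r) by exact: nbhsx_ballx.
  by exists z; split => //; move: yz; rewrite -ball_normE /ball_/= distrC.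
Qed.

(** Boundedness replaces continuity.  If |L| <= C on the ball of radius r then |L| <= C/p
    on the ball of radius r/p; comparing t v with the nearest lower multiple of v/p gives
    |L (t v) - t L v| <= 2C/p for all p.  Linearity in several variables follows
    coordinate by coordinate, partial sums of v being no larger than v. *)
Lemma local_additive_linear (L : V -> R) (r C : R) : 0 < r ->
  (forall v w, `|v| < r -> `|w| < r -> `|v + w| < r -> L (v + w) = L v + L w) ->
  (forall v, `|v| < r -> `|L v| <= C) ->
  exists xi : V, forall v, `|v| < r -> L v = dotv xi v.
Proof.
move=> r0 LD LC.
have L0 : L 0 = 0.
  have := LD 0 0; rewrite addr0 normr0 => /(_ r0 r0 r0) /eqP.
  by rewrite -subr_eq0 opprD addrA subrr sub0r oppr_eq0 => /eqP.
have LN v : `|v| < r -> L (- v) = - L v.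
  move=> vr; have := LD v (- v); rewrite normrN subrr normr0 => /(_ vr vr r0).
  by rewrite L0 => /esym/eqP; rewrite addrC addr_eq0 => /eqP.
have Lnat (n : nat) v : `|v| * n%:R < r -> L (n%:R *: v) = n%:R * L v.
  elim: n => [|n IH] vn; first by rewrite scale0r mul0r.
  have vnr : `|v| * n%:R < r.
    by apply: le_lt_trans vn; rewrite ler_wpM2l// ler_nat.
  have v1r : `|v| < r.
    by apply: le_lt_trans vn; rewrite -[leLHS]mulr1 ler_wpM2l// ler1n.
  rewrite -natr1 scalerDl scale1r mulrDl mul1r LD ?IH//.
    by rewrite normrZ ger0_norm// mulrC.
  rewrite -[X in _ + X]scale1r -scalerDl natr1 normrZ ger0_norm// mulrC//.
have LZ (t : R) v : 0 <= t <= 1 -> `|v| < r -> L (t *: v) = t * L v.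
  move=> /andP[t0 t1] vr.
  have C0 : 0 <= C by exact: le_trans (LC _ vr).
  pose D : R := L (t *: v) - t * L v.
  have main (p : nat) : (0 < p)%N -> `|D| * p%:R <= C + C.
    move=> p0.
    have p0' : 0 < p%:R :> R by rewrite ltr0n.
    (* t v = j (v / p) + s (v / p) with j an integer and 0 <= s <= 1 *)
    pose j := Num.truncn (t * p%:R).
    have /andP[jt tj] : j%:R <= t * p%:R < j.+1%:R.
      by apply: truncn_itv; rewrite mulr_ge0.
    have jp : j%:R <= p%:R :> R by apply: (le_trans jt); rewrite ler_piMl.
    pose v' := p%:R^-1 *: v.
    have v'r : `|v'| * p%:R < r.
      by rewrite normrZ ger0_norm ?invr_ge0// mulrAC mulVf ?mul1r// gt_eqF.
    have Lv' : L v = p%:R * L v' by rewrite -Lnat// scalerA divff ?scale1r// gt_eqF.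
    pose s := t * p%:R - j%:R.
    have s0 : 0 <= s by rewrite subr_ge0.
    have s1 : s <= 1 by rewrite lerBlDr nat1r ltW.
    have v1 : `|v'| < r.
      by apply: le_lt_trans v'r; rewrite -[leLHS]mulr1 ler_wpM2l// ler1n.
    have tvE : t *: v = j%:R *: v' + s *: v'.
      by rewrite -scalerDl /s addrC subrK /v' scalerA mulfK// gt_eqF.
    have jr : `|v'| * j%:R < r by apply: le_lt_trans v'r; rewrite ler_wpM2l.
    have sr : `|s *: v'| < r.
      by rewrite normrZ ger0_norm//; apply: le_lt_trans v1; rewrite ler_piMl.
    have srp : `|s *: v'| * p%:R < r.
      rewrite normrZ ger0_norm//; apply: le_lt_trans v'r.
      by rewrite ler_wpM2r// ler_piMl.
    have tr : `|t *: v| < r.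
      by rewrite normrZ ger0_norm//; apply: le_lt_trans vr; rewrite ler_piMl.
    have -> : D = L (s *: v') - s * L v'.
      rewrite /D tvE LD//; last 2 first.
      - by rewrite normrZ ger0_norm// mulrC.
      - by rewrite -tvE.
      by rewrite Lnat// Lv' /s; ring.
    rewrite -[X in _ * X](@ger0_norm _ p%:R)// -normrM mulrBl.
    apply: (le_trans (ler_normB _ _)); apply: lerD.
      rewrite mulrC -Lnat//; apply: LC.
      by rewrite normrZ ger0_norm// mulrC.
    rewrite -mulrA (mulrC (L v')) -Lv' normrM ger0_norm//.
    by rewrite (le_trans _ (LC _ vr))// ler_piMl.
  apply/eqP; rewrite -subr_eq0 -/D -normr_le0 leNgt; apply/negP => D0.
  pose p := (Num.truncn ((C + C) / `|D|)).+1.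
  have := main p isT; rewrite leNgt => /negP; apply.
  by rewrite mulrC -ltr_pdivrMr// /p truncnS_gt.
have LZ' (t : R) v : `|t| <= 1 -> `|v| < r -> L (t *: v) = t * L v.
  move=> t1 vr; have [t0|t0] := leP 0 t; first by apply: LZ => //; rewrite t0 -(ger0_norm t0).
  have tN : 0 <= - t <= 1 by rewrite oppr_ge0 ltW//= -(ltr0_norm t0).
  rewrite -[t]opprK scaleNr LN ?LZ// ?mulNr//.
  by rewrite normrZ normrN; apply: le_lt_trans vr; rewrite ler_piMl.
pose s := r / 2.
have s0 : 0 < s by rewrite divr_gt0.
have sr : s < r by rewrite ltr_pdivrMr// mulr2n mulrDr mulr1 ltrDl.
pose e (m : 'I_d) : V := delta_mx 0 m.
have coordn (v : V) (m : 'I_d) : `|v ord0 m| <= `|v|.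
  by rewrite [leRHS]/Num.norm/= mx_normrE; apply/bigmax_geP; right; exists (ord0, m).
have en m : `|e m| <= 1.
  rewrite [leLHS]/Num.norm/= mx_normrE; apply/bigmax_leP; split => // -[i j] _ /=.
  by rewrite /e mxE; case: andP => _; rewrite ?normr1 ?normr0.
have small m (t : R) : `|t| < r -> L (t *: e m) = t * (s^-1 * L (s *: e m)).
  move=> tr.
  have tsr : `|(t / 2) *: e m| < r.
    rewrite normrZ; apply: (le_lt_trans (ler_piMr _ (en m))) => //.
    by rewrite normrM (@ger0_norm _ 2^-1)//; lra.
  have sse : `|s *: e m| < r.
    by rewrite normrZ (gtr0_norm s0); apply: le_lt_trans sr; rewrite ler_piMr ?en// ltW.
  have -> : t *: e m = (t / 2) *: e m + (t / 2) *: e m by rewrite -scalerDl -splitr.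
  rewrite LD//; last first.
    rewrite -scalerDl -splitr.
    by rewrite normrZ; apply: (le_lt_trans (ler_piMr _ (en m))).
  have -> : (t / 2) *: e m = (t / r) *: (s *: e m).
    by rewrite scalerA /s; congr (_ *: _); field; rewrite gt_eqF.
  rewrite LZ'//; last by rewrite normrM normfV (gtr0_norm r0) ler_pdivrMr// mul1r ltW.
  by rewrite /s; field; rewrite gt_eqF.
exists (\row_m (s^-1 * L (s *: e m))) => v vr.
rewrite /dotv.
have vE : v = \sum_(m < d) v ord0 m *: e m by rewrite {1}(row_sum_delta v).
have partial (A : seq 'I_d) : uniq A ->
    `|\sum_(m <- A) v ord0 m *: e m| <= `|v| /\
    L (\sum_(m <- A) v ord0 m *: e m) = \sum_(m <- A) (s^-1 * L (s *: e m)) * v ord0 m.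
  have bound (B : seq 'I_d) : uniq B -> `|\sum_(m <- B) v ord0 m *: e m| <= `|v|.
    move=> uB; rewrite [leLHS]/Num.norm/= mx_normrE; apply/bigmax_leP; split => // -[i j] _ /=.
    rewrite summxE; have [jB|jB] := boolP (j \in B).
      rewrite (bigD1_seq j)//= big1 => [|m mj]; rewrite !mxE ?(ord1 i) eqxx/=.
        by rewrite eqxx mulr1 addr0.
      by rewrite eq_sym (negPf mj) mulr0.
    rewrite big1_seq ?normr0// => m /andP[_ mB]; rewrite !mxE.
    have [jm|jm] := eqVneq j m; first by rewrite jm mB in jB.
    by rewrite andbF mulr0.
  elim: A => [|m A IH] /=; first by rewrite !big_nil normr0 L0.
  move=> /andP[mA uA]; split; first by apply: bound; rewrite /= mA.
  rewrite !big_cons LD.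
  - rewrite (IH uA).2 (small m (v ord0 m)); first by congr (_ + _); rewrite mulrC.
    exact: le_lt_trans (coordn v m) vr.
  - rewrite normrZ; apply: (le_lt_trans (ler_piMr _ (en m))) => //.
    exact: le_lt_trans (coordn v m) vr.
  - exact: le_lt_trans (bound A uA) vr.
  - by apply: le_lt_trans vr; have := bound (m :: A); rewrite big_cons; apply; rewrite /= mA.
rewrite [in LHS]vE (partial _ (index_enum_uniq _)).2.
by apply: eq_bigr => m _; rewrite mxE.
Qed.

End connected_induction.

(** * Translation invariant kernels of finite rank *)

(** Near 0 the function stays between 1/2 and 3/2 by continuity, so its logarithm is
    additive and bounded. *)
Lemma local_exponential {R : realType} {d : nat} (l : 'rV[R]_d -> R) (r : R) : 0 < r ->
  (forall v, `|v| < r -> 0 < l v) ->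
  (forall v w, `|v| < r -> `|w| < r -> `|v + w| < r -> l (v + w) = l v * l w) ->
  {for 0, continuous l} ->
  exists xi : 'rV[R]_d, exists2 r', 0 < r' <= r & forall v, `|v| < r' -> l v = expR (dotv xi v).
Proof.
move=> r0 lpos lM lc.
have l0 : l 0 = 1.
  have n0 : `|0 : 'rV[R]_d| < r by rewrite normr0.
  have := lM 0 0; rewrite addr0 => /(_ n0 n0 n0) /esym/eqP.
  by rewrite -subr_eq0 -{3}[l 0]mulr1 -mulrBr mulf_eq0 gt_eqF ?lpos//= subr_eq0 => /eqP.
have : nbhs (l 0) [set y : R | `|y - 1| < 2^-1].
  apply/nbhs_ballP; exists 2^-1 => //= y; rewrite l0 /ball/= distrC.
  exact.
move=> /lc/nbhs_ballP[s /= s0 sl].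
pose r' := Num.min r s.
have r'0 : 0 < r' by rewrite lt_min r0 s0.
have r'r (v : 'rV[R]_d) : `|v| < r' -> `|v| < r.
  by move=> vr; apply: (lt_le_trans vr); rewrite ge_min lexx.
have lb v : `|v| < r' -> `|ln (l v)| <= ln 2.
  move=> vr; have lv0 := lpos v (r'r v vr).
  have : `|l v - 1| < 2^-1.
    by apply: sl; rewrite -ball_normE /ball_/= sub0r normrN (lt_le_trans vr)// ge_min lexx orbT.
  rewrite ltr_norml => /andP[h1 h2].
  rewrite ler_norml; apply/andP; split.
    by rewrite -lnV ?posrE// ler_ln ?posrE ?invr_gt0//; lra.
  by rewrite ler_ln ?posrE//; lra.
have [||xi xiE] := @local_additive_linear _ _ (fun v => ln (l v)) r' (ln 2) r'0.
- by move=> v w vr wr vwr; rewrite lM ?lnM ?posrE//; [apply: lpos|apply: lpos|..]; exact: r'r.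
- exact: lb.
exists xi, r'; first by rewrite r'0 ge_min lexx.
by move=> v vr; rewrite -xiE// lnK// posrE; apply: lpos; exact: r'r.
Qed.

Section translation_kernel.
Context {R : realType} {d n : nat}.
Local Notation V := 'rV[R]_d.
Variables (X : set V) (u : 'I_n -> V -> R).
Hypotheses (oX : open X) (cX : connected X) (X0 : X !=set0).
Hypothesis cu : forall i, continuous (u i).
Let w (x : V) : 'rV[R]_n := \row_i u i x.
Hypothesis shift : forall x y v, X x -> X y -> X (x + v) -> X (y + v) ->
  dotv (w (x + v)) (w y) = dotv (w x) (w (y + v)).
Hypothesis spanning : forall c : 'rV[R]_n, (forall x, X x -> dotv (w x) c = 0) -> c = 0.

Lemma dotvE (a b : 'rV[R]_n) : (a *m b^T) 0 0 = dotv a b.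
Proof. by rewrite /dotv mxE; apply: eq_bigr => i _; rewrite mxE. Qed.

Lemma dotv_self_eq0 (a : 'rV[R]_n) : dotv a a = 0 -> a = 0.
Proof.
move=> /eqP; rewrite psumr_eq0 => [/allP H|i _]; last by rewrite -expr2 sqr_ge0.
apply/rowP => i; rewrite mxE; apply/eqP.
by have := H i (mem_index_enum i); rewrite /= mulf_eq0 orbb.
Qed.

(** The dimension m of the span of w over a small ball around x0 does not depend on the
    ball; it is defined here as one less than the least number m' such that some ball
    contains no m' points with independent values. *)
Lemma local_span x0 : exists m r, [/\ 0 < r,
  (forall rho, 0 < rho ->
     exists2 y : 'I_m -> V, (forall i, `|y i - x0| < rho) & row_free (rows_of w y)) &
  (forall y : 'I_m -> V, (forall i, `|y i - x0| < r) -> row_free (rows_of w y) ->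
     forall x, `|x - x0| < r -> (w x <= rows_of w y)%MS)].
Proof.
pose P m := `[< exists2 rho, 0 < rho & forall y : 'I_m -> V,
  (forall i, `|y i - x0| < rho) -> ~~ row_free (rows_of w y) >].
have Pex : exists m, P m.
  exists n.+1; apply/asboolP; exists 1 => // y _; apply/negP => /eqP yn.
  by have := rank_leq_col (rows_of w y); rewrite yn ltnn.
case: (ex_minnP Pex) => -[|m] /asboolP[rho rho0 rhoP] mmin.
  have y0 (i : 'I_0) : V by case: i.
  have := rhoP y0; rewrite /row_free mxrank_eq0 flatmx0 => /(_ _)/negP; case=> //; first by case.
exists m, rho; split => //.
  move=> r r0; apply: contrapT => H; have : (m.+1 <= m)%N; last by rewrite ltnn.
  apply: mmin; apply/asboolP; exists r => // y yr; apply/negP => yfree; apply: H.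
  by exists y.
move=> y yr yfree x xr; apply: contraT => xy.
pose y' (i : 'I_m.+1) := if unlift ord0 i is Some j then y j else x.
have y'r i : `|y' i - x0| < rho by rewrite /y'; case: unliftP.
by have /negP[] := rhoP y' y'r; exact: row_free_extend.
Qed.

Lemma dotvC (a b : 'rV[R]_n) : dotv a b = dotv b a.
Proof. by apply: eq_bigr => i _; rewrite mulrC. Qed.

Lemma row_dotv_rows m (y : 'I_m -> V) (a : 'rV[R]_m) (b : 'rV[R]_n) :
  dotv (a *m rows_of w y) b = \sum_i a 0 i * dotv (w (y i)) b.
Proof.
rewrite -dotvE (mulmx_sum_row a) mulmx_suml summxE; apply: eq_bigr => i _.
by rewrite -scalemxAl mxE row_rows_of dotvE.
Qed.

(** The set of points around which c annihilates w is open; it is closed because, near a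
    limit point x2, a basis w (y_i) of the local span can be moved by v into that set.
    The vectors w (y_i + v) still form a basis of the local span: if a combination of them
    vanishes, pairing it with w (y_j - v) and using the translation invariance shows that
    the same combination of the w (y_i) is orthogonal to every w (y_j), hence zero. *)
Lemma unique_continuation (c : 'rV[R]_n) x0 r : X x0 -> 0 < r ->
  (forall x, `|x - x0| < r -> dotv (w x) c = 0) -> c = 0.
Proof.
move=> Xx0 r0 xc; apply: spanning.
pose P x := exists2 r, 0 < r & forall y, `|y - x| < r -> dotv (w y) c = 0.
suff H : forall x, X x -> P x.
  by move=> x /H[s s0]; apply; rewrite subrr normr0.
apply: (connected_ind cX); first by exists x0 => //; exists r.
  move=> x Xx [s s0 sP]; exists (s / 2); first by rewrite divr_gt0.
  move=> y yx Xy; exists (s / 2); first by rewrite divr_gt0.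
  move=> z zy; apply: sP; rewrite -(subrKA y) (splitr s).
  by apply: (le_lt_trans (ler_normD _ _)); rewrite ltrD.
move=> x2 Xx2 clP.
have [m [r1 [r10 small loc]]] := local_span x2.
have [rX rX0 rXP] := open_norm_ball oX Xx2.
(* half the radius, so that y_i + v and y_j - v stay where local_span applies *)
pose s := Num.min r1 rX / 2.
have s0 : 0 < s by rewrite divr_gt0// lt_min r10.
have s1 z : `|z - x2| < s + s -> `|z - x2| < r1.
  by rewrite -splitr lt_min => /andP[].
have sX z : `|z - x2| < s + s -> X z.
  by rewrite -splitr lt_min => /andP[_]; exact: rXP.
have [x1 [x12 Xx1 [r2 r20 r2P]]] := clP s s0.
have [y yx yfree] := small (Num.min s r2) ltac:(by rewrite lt_min s0).
pose v := x1 - x2.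
have ys i : `|y i - x2| < s by have := yx i; rewrite lt_min => /andP[].
have yr i : `|y i - x2| < r2 by have := yx i; rewrite lt_min => /andP[].
have vs : `|v| < s by [].
have yv i : `|y i + v - x2| < s + s.
  by rewrite addrAC (le_lt_trans (ler_normD _ _))// ltrD.
have yNv i : `|y i - v - x2| < s + s.
  by rewrite addrAC (le_lt_trans (ler_normB _ _))// ltrD.
have yy i : `|y i - x2| < s + s by rewrite (lt_trans (ys i))// ltrDl.
have yvfree : row_free (rows_of w (fun i => y i + v)).
  apply: inj_row_free => a a0.
  have aj j : dotv (a *m rows_of w y) (w (y j)) = 0.
    rewrite row_dotv_rows.
    have : dotv (a *m rows_of w (fun i => y i + v)) (w (y j - v)) = 0.
      by rewrite a0 /dotv big1// => i _; rewrite mxE mul0r.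
    rewrite row_dotv_rows => E; rewrite -[RHS]E; apply: eq_bigr => i _; congr (_ * _).
    have := @shift (y i) (y j - v) v; rewrite subrK => -> //; exact: sX.
  have aa : dotv (a *m rows_of w y) (a *m rows_of w y) = 0.
    by rewrite row_dotv_rows big1// => i _; rewrite dotvC aj mulr0.
  have := dotv_self_eq0 aa; move=> /eqP; rewrite mulmx_free_eq0// => /eqP.
  exact.
exists s => // x xs.
have /submxP[D ->] : (w x <= rows_of w (fun i => y i + v)%R)%MS.
  by apply: loc => // [i|]; apply: s1 => //; rewrite (lt_trans xs)// ltrDl.
rewrite row_dotv_rows big1// => i _.
by rewrite (r2P (y i + v)) ?mulr0// /v addrAC addrA subrK.
Qed.


Lemma spanning_points x0 r : X x0 -> 0 < r ->
  exists2 y : 'I_n -> V, (forall i, `|y i - x0| < r) & rows_of w y \in unitmx.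
Proof.
move=> Xx0 r0; have [m [r1 [r10 small loc]]] := local_span x0.
have [y yx yfree] := small (Num.min r r1) ltac:(by rewrite lt_min r0).
have yr i : `|y i - x0| < r by have := yx i; rewrite lt_min => /andP[].
have yr1 i : `|y i - x0| < r1 by have := yx i; rewrite lt_min => /andP[].
have ker0 : kermx (rows_of w y)^T = 0.
  apply/row_matrixP => i; rewrite row0.
  apply: (unique_continuation Xx0 r10) => x xr1.
  have /submxP[D ->] := loc y yr1 yfree x xr1.
  rewrite -dotvE -mulmxA -[rows_of w y *m _]trmxK trmx_mul trmxK.
  by rewrite -row_mul mulmx_ker row0 trmx0 mulmx0 mxE.
have mn : m = n.
  move/eqP : ker0; rewrite kermx_eq0 /row_free mxrank_tr => /eqP <-.
  by move/eqP : yfree.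
subst m; exists y => //.
by rewrite -row_free_unit.
Qed.

(** T v is the change of coordinates from a basis w (y_i) to the vectors w (y_i + v).  By
    translation invariance its adjoint moves w (z) to w (z + v) for every z in X, not only
    for z = y_i, and symmetry and multiplicativity follow from this. *)
Lemma shift_matrices : exists2 r, 0 < r & exists T : V -> 'M[R]_n,
  [/\ forall v z, `|v| < r -> X z -> X (z + v) -> w (z + v) = w z *m T v,
      forall v, `|v| < r -> (T v)^T = T v,
      forall v v', `|v| < r -> `|v'| < r -> `|v + v'| < r -> T (v + v') = T v *m T v',
      T 0 = 1%:M &
      forall i j, continuous (fun v => T v i j)].
Proof.
have [x0 Xx0] := X0; have [rX rX0 rXP] := open_norm_ball oX Xx0.
(* a third of the radius each for the points y i and for two successive translations *)
pose r := rX / 3; have r0 : 0 < r by rewrite divr_gt0.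
have rE : rX = r + r + r by rewrite /r; field.
have [y yr Yu] := spanning_points Xx0 r0.
pose Y := rows_of w y; pose Yv v := rows_of w (fun i => y i + v).
pose T v := invmx Y *m Yv v.
have YT v : Y *m T v = Yv v by rewrite mulKVmx.
have Xy i : X (y i) by apply: rXP; rewrite (lt_trans (yr i))// rE -addrA ltrDl addr_gt0.
have Xyv i v : `|v| < r -> X (y i + v).
  move=> vr; apply: rXP; rewrite addrAC (le_lt_trans (ler_normD _ _))//.
  by rewrite rE; have := yr i; lra.
have act v z : `|v| < r -> X z -> X (z + v) -> w (z + v) *m Y^T = w z *m (Yv v)^T.
  move=> vr Xz Xzv; apply/rowP => j.
  have E a (f : 'I_n -> V) : (a *m (rows_of w f)^T) 0 j = dotv a (w (f j)).
    rewrite mxE /dotv; apply: eq_bigr => i _.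
    by rewrite !mxE.
  by rewrite !E shift//; exact: Xyv.
have symY v : `|v| < r -> Yv v *m Y^T = Y *m (Yv v)^T.
  move=> vr; apply/row_matrixP => i; rewrite !row_mul !row_rows_of.
  by apply: act => //; exact: Xyv.
have Tsym v : `|v| < r -> (T v)^T = T v.
  move=> vr; apply: (can_inj (mulKmx Yu)); rewrite YT.
  rewrite /T trmx_mul trmx_inv mulmxA -symY// -mulmxA mulmxV ?mulmx1//.
  by rewrite unitmx_tr.
have TE v z : `|v| < r -> X z -> X (z + v) -> w (z + v) = w z *m T v.
  move=> vr Xz Xzv; rewrite -[T v]Tsym// /T trmx_mul mulmxA -act//.
  by rewrite trmx_inv mulmxK// unitmx_tr.
exists r => //; exists T; split => //.
- move=> v v' vr v'r vvr; apply: (can_inj (mulKmx Yu)); rewrite [RHS]mulmxA !YT.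
  apply/row_matrixP => i; rewrite row_mul !row_rows_of addrA.
  by apply: TE => //; [exact: Xyv|rewrite -addrA; exact: Xyv].
- by rewrite /T (_ : Yv 0 = Y) ?mulVmx//; apply/row_matrixP => i; rewrite !row_rows_of addr0.
- move=> i j; rewrite (_ : (fun v => _) = (fun v => \sum_(k < n) invmx Y i k * u j (y k + v))).
    apply: continuous_lincomb => k x.
    apply: (@continuous_comp V V R^o (fun v => y k + v) (u j)); last exact: cu.
    by apply: (@cvgD _ V _ (nbhs x)); [exact: cvg_cst|exact: cvg_id].
  by apply/funext => v; rewrite mxE; apply: eq_bigr => k _; rewrite !mxE.
Qed.

End translation_kernel.

Section complex_parts.
Context {R : rcfType}.
Implicit Types z : R[i].

Lemma complex_ReD z1 z2 : complex.Re (z1 + z2) = complex.Re z1 + complex.Re z2.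
Proof. by case: z1; case: z2. Qed.

Lemma complex_ImD z1 z2 : complex.Im (z1 + z2) = complex.Im z1 + complex.Im z2.
Proof. by case: z1; case: z2. Qed.

Lemma complex_Re_sum I (s : seq I) (P : pred I) (F : I -> R[i]) :
  complex.Re (\sum_(i <- s | P i) F i) = \sum_(i <- s | P i) complex.Re (F i).
Proof. by apply: (big_morph _ complex_ReD). Qed.

Lemma complex_Im_sum I (s : seq I) (P : pred I) (F : I -> R[i]) :
  complex.Im (\sum_(i <- s | P i) F i) = \sum_(i <- s | P i) complex.Im (F i).
Proof. by apply: (big_morph _ complex_ImD). Qed.

Lemma complex_ReMr z (r : R) : complex.Re (z * r%:C) = complex.Re z * r.
Proof. by case: z => a b /=; rewrite mulr0 subr0. Qed.

Lemma complex_ImMr z (r : R) : complex.Im (z * r%:C) = complex.Im z * r.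
Proof. by case: z => a b /=; rewrite mulr0 add0r. Qed.

Lemma complex_eq0 z : complex.Re z = 0 -> complex.Im z = 0 -> z = 0.
Proof. by case: z => a b /= -> ->. Qed.

Lemma conj_real (r : R) : Num.conj (r%:C : R[i]) = r%:C.
Proof. exact: conjc_real. Qed.

Lemma conj_fixed_real z : Num.conj z = z -> z = (complex.Re z)%:C.
Proof.
case: z => a b /= [] /eqP; rewrite eqNr => /eqP ->.
by [].
Qed.

End complex_parts.

Lemma fin_min_gt0 (R : realType) n (r : 'I_n -> R) : (forall k, 0 < r k) ->
  exists2 s, 0 < s & forall k, s <= r k.
Proof.
elim: n r => [|n IH] r r0; first by exists 1 => // -[].
have [s s0 sr] := IH (fun k => r (lift ord0 k)) (fun k => r0 _).
exists (Num.min s (r ord0)); first by rewrite lt_min s0 r0.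
move=> k; case: (unliftP ord0 k) => [j|] ->; last by rewrite ge_min lexx orbT.
by rewrite ge_min sr.
Qed.

Lemma dotvDr (R : pzRingType) d (a b c : 'rV[R]_d) : dotv a (b + c) = dotv a b + dotv a c.
Proof. by rewrite /dotv -big_split; apply: eq_bigr => i _; rewrite mxE mulrDr. Qed.

Section translation_kernel_exponentials.
Local Open Scope sesquilinear_scope.
Context {R : realType} {d n : nat}.
Local Notation V := 'rV[R]_d.
Local Notation C := R[i].
Variables (X : set V) (u : 'I_n -> V -> R).
Hypotheses (oX : open X) (cX : connected X) (X0 : X !=set0).
Hypothesis cu : forall i, continuous (u i).
Let w (x : V) : 'rV[R]_n := \row_i u i x.
Hypothesis shift : forall x y v, X x -> X y -> X (x + v) -> X (y + v) ->
  dotv (w (x + v)) (w y) = dotv (w x) (w (y + v)).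
Hypothesis spanning : forall c : 'rV[R]_n, (forall x, X x -> dotv (w x) c = 0) -> c = 0.

Let toC m1 m2 (A : 'M[R]_(m1, m2)) : 'M[C]_(m1, m2) := map_mx (real_complex R) A.

(** The eigenvalue l k v is real because T v is symmetric, and positive because it is the
    square of l k (v / 2) and has the inverse l k (- v). *)
Lemma diagonal_shift : exists2 P : 'M[C]_n, P \is unitarymx &
  exists2 r, 0 < r & exists xi : 'I_n -> V,
    forall v z k, `|v| < r -> X z -> X (z + v) ->
      (toC (w (z + v)) *m P^t* ) 0 k = (toC (w z) *m P^t* ) 0 k * (expR (dotv (xi k) v))%:C.
Proof.
have [r r0 [T [TE' Tsym TM T0 Tc]]] := shift_matrices oX cX X0 cu shift spanning.
have TE v z : `|v| < r -> X z -> X (z + v) -> w (z + v) = w z *m T v by exact: TE'.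
pose s := r / 2.
have s0 : 0 < s by rewrite divr_gt0.
have sr (v : V) : `|v| < s -> `|v| < r.
  by move=> /lt_trans; apply; rewrite ltr_pdivrMr// mulr2n mulrDr mulr1 ltrDl.
have ssr (v v' : V) : `|v| < s -> `|v'| < s -> `|v + v'| < r.
  by move=> vs v's; rewrite (splitr r) (le_lt_trans (ler_normD _ _))// ltrD.
pose S : set 'M[C]_n := [set toC (T v) | v in [set v | `|v| < s]].
have toC_herm (A : 'M[R]_n) : A^T = A -> (toC A)^t* = toC A.
  move=> AT; rewrite -{2}AT; apply/matrixP => i j; rewrite !mxE; exact: conj_real.
have [||P Pu Pdiag] := @hermitian_codiagonalization C n S.
- by move=> _ [v vs <-]; apply: toC_herm; apply: Tsym; exact: sr.
- move=> _ _ [v vs <-] [v' v's <-]; rewrite -!map_mxM -!TM; [by rewrite addrC|..]; try exact: sr.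
    by rewrite addrC; exact: ssr.
  exact: ssr.
have PP : P^t* *m P = 1%:M.
  by rewrite -invmx_unitary// mulVmx// unitarymx_unit.
pose Lam v := P *m toC (T v) *m P^t*.
have LamE v : Lam v = P *m toC (T v) *m P^t* by [].
move: LamE; clearbody Lam => LamE.
have LamD v k j : `|v| < s -> k != j -> Lam v k j = 0.
  move=> vs kj; have /is_diag_mxP : is_diag_mx (Lam v) by rewrite LamE; apply: Pdiag; exists v.
  exact.
pose l k v : R := complex.Re (Lam v k k).
have lE k v : `|v| < s -> Lam v k k = (l k v)%:C.
  move=> vs; apply: conj_fixed_real.
  have : (Lam v)^t* = Lam v.
    rewrite LamE !trmx_mul !map_mxM trmxCK toC_herm; last by apply: Tsym; exact: sr.
    by rewrite mulmxA.
  by move=> /matrixP/(_ k k); rewrite !mxE.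
have LamM v v' : `|v| < s -> `|v'| < s -> Lam (v + v') = Lam v *m Lam v'.
  move=> vs v's; rewrite !LamE TM; [|exact: sr|exact: sr|exact: ssr].
  by rewrite /toC map_mxM !mulmxA -[X in _ = X *m _ *m _]mulmxA PP mulmx1.
have lM k v v' : `|v| < s -> `|v'| < s -> `|v + v'| < s -> l k (v + v') = l k v * l k v'.
  move=> vs v's vvs; apply: (@complexI R).
  rewrite -(lE k _ vvs) (LamM _ _ vs v's) mxE (bigD1 k)//= big1 ?addr0 => [|j jk].
    by rewrite (lE k v vs) (lE k v' v's); apply/esym; exact: rmorphM.
  have kj : k != j by rewrite eq_sym.
  by rewrite (LamD v k j vs kj) mul0r.
have l0 k : l k 0 = 1.
  apply: (@complexI R); rewrite -lE ?normr0// LamE T0 /toC map_mx1 mulmx1.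
  by rewrite (unitarymxP _) // mxE eqxx.
have lpos k v : `|v| < s -> 0 < l k v.
  move=> vs; have vN : `|- v| < s by rewrite normrN.
  have v2 : `|2^-1 *: v| < s.
    by rewrite normrZ gtr0_norm ?invr_gt0// (le_lt_trans _ vs)// ler_piMl// invf_le1// ler1n.
  have vE : v = 2^-1 *: v + 2^-1 *: v 
    by rewrite -scalerDl (_ : 2^-1 + 2^-1 = 1 :> R) ?scale1r//; field.
  have sq : l k v = l k (2^-1 *: v) ^+ 2 by rewrite {1}vE lM -?vE// expr2.
  rewrite lt_neqAle {2}sq sqr_ge0 andbT eq_sym; apply/eqP => lv0.
  have := lM k v (- v) vs vN; rewrite subrr normr0 => /(_ s0).
  by rewrite l0 lv0 mul0r => /eqP; rewrite oner_eq0.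
have lc k : continuous (l k).
  rewrite (_ : l k = (fun v => \sum_(i < n) 1 *
      (\sum_(j < n) complex.Re (P k i * Num.conj (P k j)) * T v i j))).
    by apply: continuous_lincomb => i; apply: continuous_lincomb => j; exact: Tc.
  apply/funext => v; rewrite /l LamE !mxE complex_Re_sum.
  under eq_bigr do rewrite !mxE mulr_suml complex_Re_sum.
  rewrite exchange_big; apply: eq_bigr => i _; rewrite mul1r; apply: eq_bigr => j _.
  by rewrite !mxE -complex_ReMr; congr complex.Re; rewrite mulrAC.
have /choice[xi xiP] k := local_exponential s0 (lpos k) (lM k) (lc k 0).
have /choice[r' r'P] k : exists r', 0 < r' <= s /\
    forall v, `|v| < r' -> l k v = expR (dotv (xi k) v).
  by have [r' h1 h2] := xiP k; exists r'.
have [t t0 tr'] := fin_min_gt0 (r := r') ltac:(by move=> k; have [/andP[]] := r'P k).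
exists P => //; exists (Num.min t s); first by rewrite lt_min t0.
exists xi => v z k; rewrite lt_min => /andP[vt vs] Xz Xzv.
have <- : l k v = expR (dotv (xi k) v).
  by have [_] := r'P k; apply; exact: lt_le_trans vt (tr' k).
rewrite -lE// (TE v)//; last exact: sr.
have -> : toC (w z *m T v) *m P^t* = toC (w z) *m P^t* *m Lam v.
  by rewrite /toC map_mxM LamE !mulmxA -[X in _ = X *m _ *m _]mulmxA PP mulmx1.
rewrite mxE (bigD1 k)//= big1 ?addr0// => j jk.
by rewrite LamD// mulr0.
Qed.

(** In the eigenbasis the coordinate h z 0 k equals g k * exp(xi_k.z): the quotient of both
    sides is locally constant on the connected set X.  The g k are nonzero and the xi_k
    distinct, as otherwise the coordinates would be linearly dependent and w would not span.
    The change of basis is unitary, so w x . w y is the Hermitian product of h x and h y,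
    which gives the positive coefficients |g k|^2. *)
Lemma translation_kernel_exponentials : exists (xi : 'I_n -> V) (c : 'I_n -> R),
  [/\ injective xi, forall k, 0 < c k &
      forall x y, X x -> X y ->
        dotv (w x) (w y) = \sum_(k < n) c k * expR (dotv (xi k) (x + y))].
Proof.
have [P Pu [r r0 [xi hS]]] := diagonal_shift.
have [x0 Xx0] := X0.
have PP : P^t* *m P = 1%:M.
  by rewrite -invmx_unitary// mulVmx// unitarymx_unit.
pose h z : 'rV[C]_n := toC (w z) *m P^t*.
pose g k := h x0 0 k * (expR (- dotv (xi k) x0))%:C.
have hE z k : X z -> h z 0 k = g k * (expR (dotv (xi k) z))%:C.
  move=> Xz; suff <- : h z 0 k * (expR (- dotv (xi k) z))%:C = g k.
    by rewrite -mulrA -rmorphM /= -expRD addNr expR0 mulr1.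
  move: z Xz; apply: (connected_ind cX); first by exists x0.
    move=> x Xx hx; exists r => // y yx Xy; rewrite -hx.
    have yE : y = x + (y - x) by rewrite addrC subrK.
    rewrite {1}yE /h hS// -?yE// -mulrA -rmorphM/= -expRD.
    have D : dotv (xi k) y = dotv (xi k) x + dotv (xi k) (y - x) by rewrite -dotvDr -yE.
    by congr (_ * (expR _)%:C); rewrite D; ring.
  move=> x Xx /(_ r r0)[y [yx Xy <-]].
  have xE : x = y + (x - y) by rewrite addrC subrK.
  rewrite {1}xE /h hS// -?xE//; last by rewrite distrC.
  rewrite -mulrA -rmorphM/= -expRD.
  have D : dotv (xi k) x = dotv (xi k) y + dotv (xi k) (x - y) by rewrite -dotvDr -xE.
  by congr (_ * (expR _)%:C); rewrite D; ring.
have hindep (b : 'rV[C]_n) : (forall z, X z -> (h z *m b^T) 0 0 = 0) -> b = 0.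
  move=> hb; pose q := P^t* *m b^T.
  have hq z : X z -> \sum_i (q i 0) * (u i z)%:C = 0.
    move=> /hb; rewrite /h -mulmxA mxE => E; rewrite -[RHS]E; apply: eq_bigr => i _.
    by rewrite mulrC !mxE.
  have q0 : q = 0.
    have re0 : \row_i complex.Re (q i 0) = 0.
      apply: spanning => z /hq /(congr1 (@complex.Re R)); rewrite complex_Re_sum /= => <-.
      by apply: eq_bigr => i _; rewrite !mxE complex_ReMr mulrC.
    have im0 : \row_i complex.Im (q i 0) = 0.
      apply: spanning => z /hq /(congr1 (@complex.Im R)); rewrite complex_Im_sum /= => <-.
      by apply: eq_bigr => i _; rewrite !mxE complex_ImMr mulrC.
    apply/colP => i; rewrite [RHS]mxE; apply: complex_eq0.
      by move/rowP/(_ i) : re0; rewrite !mxE.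
    by move/rowP/(_ i) : im0; rewrite !mxE.
  apply: trmx_inj; rewrite trmx0 -[LHS]mul1mx -(unitarymxP Pu) -mulmxA.
  by rewrite -/q q0 mulmx0.
have g0 k : g k != 0.
  apply/eqP => gk0.
  have : delta_mx 0 k = 0 :> 'rV[C]_n.
    apply: hindep => z Xz; rewrite mxE (bigD1 k)//= big1 => [|j jk].
      by rewrite hE// gk0 !mul0r addr0.
    by rewrite !mxE eqxx/= (negPf jk) mulr0.
  by move/rowP/(_ k)/eqP; rewrite !mxE !eqxx oner_eq0.
have xi_inj : injective xi.
  move=> k k' kk'; apply/eqP; apply: contraT => kneq.
  have : g k' *: delta_mx 0 k - g k *: delta_mx 0 k' = 0 :> 'rV[C]_n.
    apply: hindep => z Xz.
    have -> : (g k' *: delta_mx 0 k - g k *: delta_mx 0 k')^T =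
        g k' *: delta_mx k 0 - g k *: delta_mx k' 0 :> 'cV[C]_n.
      by apply/colP => i; rewrite !mxE !andbT.
    rewrite mulmxBr -!scalemxAr -!colE.
    have cE (a : C) j : (a *: col j (h z)) 0 0 = a * h z 0 j by rewrite mxE mxE.
    have BE (A B : 'M[C]_1) : (A - B) 0 0 = A 0 0 - B 0 0 by rewrite !mxE.
    rewrite BE !cE.
    by rewrite !hE// kk'; ring.
  move=> /rowP/(_ k)/eqP; rewrite !mxE !eqxx/= (negPf kneq) mulr0 subr0 mulr1.
  by rewrite (negPf (g0 k')).
exists xi, (fun k => complex.Re (g k * Num.conj (g k))); split => //.
  move=> k; have : 0 < g k * Num.conj (g k) by rewrite -normCK exprn_gt0// normr_gt0.
  by rewrite ltcE/= => /andP[].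
move=> x y Xx Xy; apply: (@complexI R).
have -> : (dotv (w x) (w y))%:C = (h x *m (h y)^t* ) 0 0.
  rewrite /h trmx_mul map_mxM trmxCK mulmxA -(mulmxA _ _ P) PP mulmx1.
  rewrite mxE /dotv rmorph_sum; apply: eq_bigr => i _.
  by rewrite rmorphM/= !mxE conj_real.
have -> (a b : 'rV[C]_n) : (a *m b^t* ) 0 0 = \sum_k a 0 k * Num.conj (b 0 k).
  by rewrite mxE; apply: eq_bigr => k _; rewrite !mxE.
rewrite rmorph_sum; apply: eq_bigr => k _.
rewrite !hE// dotvDr expRD.
have -> (a : C) (b : R) : Num.conj (a * b%:C) = Num.conj a * b%:C.
  by rewrite rmorphM /=; congr (_ * _); exact: conj_real.
have E : (complex.Re (g k * Num.conj (g k)))%:C = g k * Num.conj (g k).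
  by apply/esym/conj_fixed_real; rewrite rmorphM/= conjCK mulrC.
transitivity ((complex.Re (g k * Num.conj (g k)))%:C *
  ((expR (dotv (xi k) x))%:C * (expR (dotv (xi k) y))%:C)).
  by rewrite E; ring.
by rewrite [RHS]rmorphM; congr (_ * _); apply/esym; exact: rmorphM.
Qed.

End translation_kernel_exponentials.

(** * Exponentials and complex integrals *)

Section exponentials.
Context {R : realType} {d : nat}.
Local Notation V := 'rV[R]_d.
Local Notation mu := (@rV_lebesgue R d).

Definition expv (xi x : V) : R := expR (dotv xi x).

Lemma expvD xi x y : expv xi (x + y) = expv xi x * expv xi y.
Proof. by rewrite /expv dotvDr expRD. Qed.

(** By induction on the number of terms.  Subtracting exp(xi_0.v) times the relation from
    its translate by v removes the term of index 0 and multiplies the coefficient a_k by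
    exp(xi_k.v) - exp(xi_0.v), which is nonzero for v a multiple of xi_k - xi_0. *)
Lemma expv_independent n (xi : 'I_n -> V) (a : 'I_n -> R) (U : set V) :
  injective xi -> open U -> U !=set0 ->
  (forall x, U x -> \sum_(k < n) a k * expv (xi k) x = 0) -> forall k, a k = 0.
Proof.
elim: n xi a U => [|n IH] xi a U xi_inj oU [x1 Ux1] aU; first by case.
have [r r0 rU] := open_norm_ball oU Ux1.
have r20 : 0 < r / 2 by rewrite divr_gt0.
have step v k : `|v| < r / 2 ->
    a (lift ord0 k) * (expv (xi (lift ord0 k)) v - expv (xi ord0) v) = 0.
  move=> vr; apply: (IH (fun k => xi (lift ord0 k))
    (fun k => a (lift ord0 k) * (expv (xi (lift ord0 k)) v - expv (xi ord0) v))
    (ball x1 (r / 2))).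
  - by move=> i j /xi_inj/lift_inj.
  - exact: (@ball_open R V).
  - by exists x1; exact: ballxx.
  move=> x; rewrite -ball_normE /ball_/= distrC => xr.
  have xvU : U (x + v).
    by apply: rU; rewrite addrAC (splitr r) (le_lt_trans (ler_normD _ _))// ltrD.
  have xU : U x by apply: rU; rewrite (lt_trans xr)// [ltRHS]splitr ltrDl.
  transitivity (\sum_(k < n.+1) a k * expv (xi k) (x + v) -
      expv (xi ord0) v * \sum_(k < n.+1) a k * expv (xi k) x).
    rewrite mulr_sumr -sumrB big_ord_recl expvD.
    rewrite [X in _ = X + _](_ : _ = 0) ?add0r; last by ring.
    by apply: eq_bigr => i _; rewrite expvD; ring.
  by rewrite !aU// mulr0 subr0.
have alift k : a (lift ord0 k) = 0.
  pose w := xi (lift ord0 k) - xi ord0.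
  have w0 : w != 0.
    by rewrite subr_eq0; apply/eqP => /xi_inj.
  have nw : 0 < `|w| by rewrite normr_gt0.
  pose t := r / 4 / `|w|.
  have t0 : 0 < t by rewrite !divr_gt0.
  have vr : `|t *: w| < r / 2.
    by rewrite normrZ gtr0_norm// /t divfK ?gt_eqF// ltr_pM2l// ltf_pV2 ?posrE// ltr_nat.
  have := step _ k vr; move=> /eqP; rewrite mulf_eq0 => /orP[/eqP//|].
  rewrite subr_eq0 /expv => /eqP/expR_inj/eqP.
  have -> : dotv (xi (lift ord0 k)) (t *: w) = t * dotv w w + dotv (xi ord0) (t *: w).
    by rewrite /dotv mulr_sumr -big_split; apply: eq_bigr => m _; rewrite /w !mxE /=; ring.
  rewrite -subr_eq0 addrK.
  by rewrite mulf_eq0 gt_eqF//= => /eqP/dotv_self_eq0 /eqP; rewrite (negPf w0).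
move=> k; case: (unliftP ord0 k) => [j|] ->; first exact: alift.
have := aU _ Ux1; rewrite big_ord_recl big1 ?addr0 => [/eqP|i _]; last by rewrite alift mul0r.
by rewrite mulf_eq0 (gt_eqF (expR_gt0 _)) orbF => /eqP.
Qed.

Lemma continuous_dotv (xi : V) : continuous (fun x : V => dotv xi x).
Proof. by apply: continuous_lincomb => m; exact: continuous_rV_coord. Qed.

Lemma continuous_expv (xi : V) : continuous (expv xi).
Proof.
move=> x; apply: (@continuous_comp V R^o R^o (fun x => dotv xi x) expR).
  exact: continuous_dotv.
exact: continuous_expR.
Qed.

Lemma expv_bounded (X : set V) (xi : V) : bounded_set X ->
  exists M, forall x, X x -> `|expv xi x| <= M.
Proof.
move=> /bounded_subset_ball[M M0 XM].
exists (expR (\sum_(m < d) `|xi ord0 m| * M)) => x /XM.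
rewrite rV_ballE// => /= xM; rewrite ger0_norm ?expR_ge0// ler_expR.
apply: ler_sum => m _; apply: (le_trans (ler_norm _)); rewrite normrM ler_wpM2l//.
by have := xM m; rewrite mxE subr0 => /ltW.
Qed.

End exponentials.

Section complex_integral.
Context {R : realType} {d : nat}.
Local Notation V := 'rV[R]_d.
Local Notation mu := (@rV_lebesgue R d).
Variable D : set V.
Hypothesis mD : measurable D.
Implicit Types (g h : V -> R[i]).

Definition cintegrable h :=
  mu.-integrable D (EFin \o (fun x => complex.Re (h x))) /\
  mu.-integrable D (EFin \o (fun x => complex.Im (h x))).

Lemma eq_cintegral g h : (forall x, D x -> g x = h x) -> cintegral D g = cintegral D h.
Proof.
by move=> gh; rewrite /cintegral; congr (_ +i* _); apply: eq_Rintegral => x /set_mem /gh ->.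
Qed.

Lemma cintegralD g h : cintegrable g -> cintegrable h ->
  cintegral D (fun x => g x + h x) = cintegral D g + cintegral D h.
Proof.
move=> [g1 g2] [h1 h2]; rewrite /cintegral /=.
under eq_Rintegral do rewrite complex_ReD.
under [X in _ +i* X]eq_Rintegral do rewrite complex_ImD.
by rewrite !RintegralD.
Qed.

Lemma cintegrableZ (a : R[i]) h : cintegrable h -> cintegrable (fun x => a * h x).
Proof.
case: a => a b [h1 h2]; split.
  have := integrableB mD (integrableZl mD a h1) (integrableZl mD b h2).
  by apply: eq_integrable => // x _ /=; case: (h x).
have := integrableD mD (integrableZl mD a h2) (integrableZl mD b h1).
by apply: eq_integrable => // x _ /=; case: (h x).
Qed.

Lemma cintegrableD g h : cintegrable g -> cintegrable h -> cintegrable (fun x => g x + h x).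
Proof.
move=> [g1 g2] [h1 h2]; split.
  by have := integrableD mD g1 h1; apply: eq_integrable => // x _ /=; rewrite complex_ReD.
by have := integrableD mD g2 h2; apply: eq_integrable => // x _ /=; rewrite complex_ImD.
Qed.

Lemma cintegralZ (a : R[i]) h : cintegrable h ->
  cintegral D (fun x => a * h x) = a * cintegral D h.
Proof.
case: a => a b [h1 h2]; rewrite /cintegral /=.
have E1 x : x \in D -> complex.Re ((a +i* b) * h x) = a * complex.Re (h x) - b * complex.Im (h x).
  by case: (h x).
have E2 x : x \in D -> complex.Im ((a +i* b) * h x) = a * complex.Im (h x) + b * complex.Re (h x).
  by case: (h x).
rewrite (eq_Rintegral _ E1) (eq_Rintegral _ E2) RintegralB ?RintegralD ?RintegralZl//.
- by have := integrableZl mD a h2; apply: eq_integrable.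
- by have := integrableZl mD b h1; apply: eq_integrable.
- by have := integrableZl mD a h1; apply: eq_integrable.
- by have := integrableZl mD b h2; apply: eq_integrable.
Qed.

Lemma cintegrable_lincomb n (a : 'I_n -> R[i]) (F : 'I_n -> V -> R[i]) :
  (forall i, cintegrable (F i)) -> cintegrable (fun x => \sum_(i < n) a i * F i x).
Proof.
elim: n a F => [|n IH] a F iF.
  rewrite (_ : (fun _ => _) = (fun=> 0)); last by apply/funext => x; rewrite big_ord0.
  by split; exact: integrable0.
under eq_fun do rewrite big_ord_recl.
apply: cintegrableD; first exact: cintegrableZ.
exact: (IH (fun i => a (lift ord0 i)) (fun i => F (lift ord0 i)) (fun i => iF _)).
Qed.

Lemma cintegral_lincomb n (a : 'I_n -> R[i]) (F : 'I_n -> V -> R[i]) :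
  (forall i, cintegrable (F i)) ->
  cintegral D (fun x => \sum_(i < n) a i * F i x) = \sum_(i < n) a i * cintegral D (F i).
Proof.
elim: n a F => [|n IH] a F iF.
  rewrite big_ord0 (_ : (fun _ => _) = (fun=> 0)); last by apply/funext => x; rewrite big_ord0.
  by rewrite /cintegral/= /Rintegral integral0.
under eq_fun do rewrite big_ord_recl.
rewrite cintegralD; [|exact: cintegrableZ|].
  by rewrite (IH (fun i => a (lift ord0 i)) (fun i => F (lift ord0 i)))// cintegralZ// big_ord_recl.
exact: (cintegrable_lincomb (fun i => a (lift ord0 i)) (F := fun i => F (lift ord0 i))).
Qed.

Lemma cintegral_conj h : cintegrable h -> cintegral D (fun x => (h x)^*) = (cintegral D h)^*.
Proof.
move=> [h1 h2]; rewrite /cintegral/=; congr (_ +i* _).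
  by apply: eq_Rintegral => x _; case: (h x).
transitivity (\int[mu]_(x in D) (-1 * complex.Im (h x))).
  by apply: eq_Rintegral => x _; case: (h x) => a b /=; rewrite mulN1r.
by rewrite RintegralZl// mulN1r.
Qed.

End complex_integral.

(** * From exponentials to positivity and rank *)

Section L2_facts.
Context {R : realType} {d : nat}.
Local Notation V := 'rV[R]_d.
Local Notation mu := (@rV_lebesgue R d).

Lemma normc_sqr (z : R[i]) : Normc.normc z ^+ 2 = complex.Re z ^+ 2 + complex.Im z ^+ 2.
Proof. by case: z => a b /=; rewrite sqr_sqrtr// addr_ge0 ?sqr_ge0. Qed.

(** On a set of finite measure, from |p| <= 1 + p^2. *)
Lemma L2_cintegrable (D : set V) (h : V -> R[i]) : measurable D -> (mu D < +oo)%E ->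
  L2 D h -> cintegrable D h.
Proof.
move=> mD Dfin [mre mim fin].
have mn : measurable_fun D (fun x => Normc.normc (h x) ^+ 2).
  under eq_fun do rewrite normc_sqr.
  by apply: measurable_funD; exact: measurable_funX.
have dom : mu.-integrable D (EFin \o (fun x => 1 + Normc.normc (h x) ^+ 2)).
  have i1 : mu.-integrable D (EFin \o (fun=> 1 : R)).
    apply: measurable_bounded_integrable => //; exists 1; split; first by rewrite num_real.
    by move=> N N1 x _; rewrite normr1 ltW.
  have i2 : mu.-integrable D (EFin \o (fun x => Normc.normc (h x) ^+ 2)).
    apply/integrableP; split; first exact/measurable_EFinP.
    by under eq_integral do rewrite /= ger0_norm ?sqr_ge0//.
  by have := integrableD mD i1 i2; apply: eq_integrable.
have key (p q : R) : `|p| <= 1 + (p ^+ 2 + q ^+ 2).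
  have [p0|p0] := leP 0 p; last rewrite ltr0_norm//; first rewrite ger0_norm//.
    by have := sqr_ge0 (p - 1); have := sqr_ge0 q; nra.
  by have := sqr_ge0 (p + 1); have := sqr_ge0 q; nra.
split; apply: le_integrable dom => //; try exact/measurable_EFinP.
  move=> x _ /=; rewrite lee_fin normc_sqr [leRHS]ger0_norm; first exact: key.
  by rewrite !addr_ge0 ?sqr_ge0.
move=> x _ /=; rewrite lee_fin normc_sqr [leRHS]ger0_norm; last by rewrite !addr_ge0 ?sqr_ge0.
by rewrite [X in _ <= 1 + X]addrC; exact: key.
Qed.

Lemma real_bounded_L2 (D : set V) (g : V -> R) (M : R) : measurable D -> (mu D < +oo)%E ->
  measurable_fun setT g -> (forall x, D x -> `|g x| <= M) -> L2 D (fun x => (g x)%:C).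
Proof.
move=> mD Dfin mg gM; split => /=.
- exact: measurable_funTS.
- exact: measurable_cst.
under eq_integral do rewrite /= expr0n addr0 sqr_sqrtr ?sqr_ge0//.
apply: integrable_lty => //; apply: measurable_bounded_integrable => //.
  by apply: measurable_funTS; exact: measurable_funX.
exists (M ^+ 2); split; first by rewrite num_real.
move=> N MN x Dx; apply: le_trans (ltW MN).
by rewrite normrX; apply: lerXn2r (gM x Dx); rewrite nnegrE// (le_trans _ (gM x Dx)).
Qed.

Variable X : set V.
Hypotheses (oX : open X) (bX : bounded_set X).

Lemma open_set_add : open (set_add X X).
Proof.
rewrite openE => _ [x Xx [y Xy <-]].
have [r r0 rX] := open_norm_ball oX Xy.
apply/nbhs_ballP; exists r => //= z; rewrite -ball_normE /ball_/= distrC => zr.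
exists x => //; exists (z - x); last by rewrite addrC subrK.
by apply: rX; rewrite -addrA -opprD.
Qed.

Lemma measurable_set_add : measurable (set_add X X).
Proof. by apply: open_measurable_rV; exact: open_set_add. Qed.

Lemma set_add_lty : (mu (set_add X X) < +oo)%E.
Proof.
have [M M0 XM] := bounded_subset_ball bX.
apply: (@le_lt_trans _ _ (mu (ball 0 (M + M)))).
  apply: le_measure; rewrite ?inE//; [exact: measurable_set_add|exact: measurable_rV_ball|].
  move=> _ [x Xx [y Xy <-]]; have := XM _ Xx; have := XM _ Xy.
  rewrite -!ball_normE /ball_/= !sub0r !normrN => yM xM.
  by rewrite (le_lt_trans (ler_normD _ _))// ltrD.
by rewrite rV_lebesgue_ball ?ltry// addr_gt0.
Qed.

Lemma set_add_trans_measurable (p : V -> R) x : X x -> measurable_fun (set_add X X) p ->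
  measurable_fun X (fun y => p (x + y)).
Proof.
move=> Xx mp.
apply: (@measurable_comp _ _ _ _ _ _ (set_add X X) p _ (fun y => x + y)).
- exact: measurable_set_add.
- by move=> _ [y Xy <-]; exists x => //; exists y.
- exact: mp.
- by apply: measurable_funTS; exact: measurable_rV_translation.
Qed.

Lemma ae_eq_set_add_trans T (p q : V -> T) x : X x -> ae_eq mu (set_add X X) p q ->
  ae_eq mu X (fun y => p (x + y)) (fun y => q (x + y)).
Proof.
move=> Xx /(negligible_rV_translation x); apply: negligibleS => y /= H.
by apply: contra_not H => H Xy; apply: H; exists x => //; exists y.
Qed.

(** X + X is the union of countably many translates q + X with q rational, as X is
    open. *)
Lemma set_add_ae_eq T (p q : V -> T) :
  (forall x, X x -> ae_eq mu X (fun y => p (x + y)) (fun y => q (x + y))) ->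
  ae_eq mu (set_add X X) p q.
Proof.
move=> H.
pose Q (a : 'rV[rat]_d) : V := map_mx ratr a.
pose Ng (a : 'rV[rat]_d) := [set z | X (Q a) /\ X (z - Q a) /\ p z <> q z].
have Nneg a : mu.-negligible (Ng a).
  have [XQ|nXQ] := pselect (X (Q a)); last first.
    by apply: negligibleS (@negligible_set0 _ _ _ mu) => z [].
  apply: negligibleS (negligible_rV_translation (- Q a) (H _ XQ)) => z [_ [Xz pq]] /=.
  have Xz' : X (- Q a + z) by rewrite addrC.
  by rewrite addNKr => /(_ Xz').
pose F k := if @unpickle 'rV[rat]_d k is Some a then Ng a else set0.
have Fneg k : mu.-negligible (F k).
  by rewrite /F; case: unpickle => [a|]; [exact: Nneg|exact: negligible_set0].
apply: negligibleS (negligible_bigcup Fneg) => z /= /not_implyP[[x Xx [y Xy xyz]] pq].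
have [r r0 rX] := open_norm_ball oX Xy.
have [||a [Xa ar]] := @rat_rV_dense _ _ (X `&` ball x r).
- by apply: openI => //; exact: (@ball_open R V).
- by exists x; split => //; exact: ballxx.
exists (pickle a) => //; rewrite /F pickleK; split => //; split => //.
apply: rX; rewrite -xyz addrAC addrK.
by move: ar; rewrite -ball_normE.
Qed.

End L2_facts.

Section exponential_kernels.
Context {R : realType} {d : nat}.
Local Notation V := 'rV[R]_d.
Local Notation mu := (@rV_lebesgue R d).
Variable X : set V.
Hypotheses (oX : open X) (bX : bounded_set X) (X0 : X !=set0).
Variables (K : nat) (xi : 'I_K -> V) (c : 'I_K -> R) (f : V -> R[i]).
Hypotheses (xi_inj : injective xi) (c0 : forall k, 0 < c k).
Hypothesis f_L2 : L2 (set_add X X) f.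
Hypothesis fE : L2_eq (set_add X X) f
  (fun x => \sum_(k < K) (c k * expR (dotv (xi k) x))%:C).

Let mX : measurable X. Proof. exact: open_measurable_rV. Qed.
Let Xfin : (mu X < +oo)%E. Proof. exact: bounded_rV_lebesgue_lty. Qed.

Let e k (x : V) : R[i] := (expv (xi k) x)%:C.
Let m k (g : V -> R[i]) : R[i] := cintegral X (fun y => e k y * g y).

Lemma bounded_cintegrable (p : V -> R) (g : V -> R[i]) M :
  measurable_fun setT p -> (forall x, X x -> `|p x| <= M) -> cintegrable X g ->
  cintegrable X (fun x => (p x)%:C * g x).
Proof.
move=> mp pM [g1 g2].
have bp : [bounded p x | x in X].
  exists M; split; first by rewrite num_real.
  by move=> N MN x Xx; apply: le_trans (ltW MN); exact: pM.
have mpX : measurable_fun X p by exact: measurable_funTS.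
split.
  have := integrableMr mX mpX bp g1.
  by apply: eq_integrable => // x _ /=; case: (g x) => a b /=; rewrite mul0r subr0.
have := integrableMr mX mpX bp g2.
by apply: eq_integrable => // x _ /=; case: (g x) => a b /=; rewrite mul0r addr0.
Qed.

Lemma expv_measurable k : measurable_fun setT (expv (xi k)).
Proof. by apply: continuous_measurable_rV; exact: continuous_expv. Qed.

Lemma expv_cintegrable k g : cintegrable X g -> cintegrable X (fun x => e k x * g x).
Proof.
move=> ig; have [M eM] := expv_bounded (xi k) bX.
by apply: bounded_cintegrable eM ig; exact: expv_measurable.
Qed.

(** The hypothesis on f only holds almost everywhere on X + X, but for each fixed x it
    holds at x + y for almost every y, so the correlation is known at every x. *)
Lemma corr_exponentials g x : L2 X g -> X x ->
  corr_op X f g x = \sum_(k < K) (c k)%:C * m k g * e k x.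
Proof.
move=> gL2 Xx.
have ig := L2_cintegrable mX Xfin gL2.
have [g1 g2 _] := gL2; have [f1 f2 _] := f_L2.
have fxE := ae_eq_set_add_trans Xx fE.
pose E y := \sum_(k < K) ((c k)%:C * e k x) * (e k y * g y).
have EE y : (\sum_(k < K) (c k * expR (dotv (xi k) (x + y)))%:C) * g y = E y.
  rewrite mulr_suml; apply: eq_bigr => k _.
  by rewrite -/(expv (xi k) (x + y)) expvD !rmorphM/= !mulrA.
have iE : cintegrable X E.
  by apply: cintegrable_lincomb => // k; exact: expv_cintegrable.
have mf1 := set_add_trans_measurable oX Xx f1.
have mf2 := set_add_trans_measurable oX Xx f2.
have m1 : measurable_fun X (fun y => complex.Re (f (x + y) * g y)).
  rewrite (_ : (fun _ => _) = (fun y =>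
      complex.Re (f (x + y)) * complex.Re (g y) - complex.Im (f (x + y)) * complex.Im (g y))).
    by apply: measurable_funB; apply: measurable_funM.
  by apply/funext => y; case: (f _) => a b; case: (g y).
have m2 : measurable_fun X (fun y => complex.Im (f (x + y) * g y)).
  rewrite (_ : (fun _ => _) = (fun y =>
      complex.Re (f (x + y)) * complex.Im (g y) + complex.Im (f (x + y)) * complex.Re (g y))).
    by apply: measurable_funD; apply: measurable_funM.
  by apply/funext => y; case: (f _) => a b; case: (g y).
transitivity (cintegral X E).
  rewrite /corr_op /cintegral; congr (_ +i* _); rewrite /Rintegral; congr fine;
    apply: ae_eq_integral => //.
  - exact/measurable_EFinP.
  - exact: measurable_int iE.1.
  - by apply: filterS fxE => y H /H /= ->; rewrite EE.
  - exact/measurable_EFinP.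
  - exact: measurable_int iE.2.
  - by apply: filterS fxE => y H /H /= ->; rewrite EE.
rewrite cintegral_lincomb// => [|k]; last exact: expv_cintegrable.
by apply: eq_bigr => k _; rewrite mulrAC.
Qed.

Lemma exponentials_psd : L2_psd X (corr_op X f).
Proof.
move=> g gL2; have ig := L2_cintegrable mX Xfin gL2.
have igc : cintegrable X (fun x => (g x)^*).
  have [g1 g2] := ig; split.
    by apply: eq_integrable g1 => // x _ /=; case: (g x).
  have := integrableN g2.
  by apply: eq_integrable => // x _ /=; case: (g x).
pose E x := \sum_(k < K) ((c k)%:C * m k g) * (e k x * (g x)^*).
rewrite /L2_inner (@eq_cintegral _ _ _ _ E); last first.
  move=> x Xx; rewrite corr_exponentials// mulr_suml.
  by apply: eq_bigr => k _; rewrite !mulrA.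
rewrite cintegral_lincomb// => [|k]; last exact: expv_cintegrable.
apply: sumr_ge0 => k _.
have -> : cintegral X (fun x => e k x * (g x)^*) = (m k g)^*.
  rewrite -cintegral_conj//; last exact: expv_cintegrable.
  apply: eq_cintegral => x Xx; rewrite [RHS]rmorphM/=; congr (_ * _).
  by apply/esym; exact: conjc_real.
rewrite -mulrA mulr_ge0//; first by rewrite lecR ltW.
exact: mul_conjC_ge0.
Qed.

Lemma exponentials_independent (b : 'I_K -> R[i]) :
  L2_eq X (fun x => \sum_(k < K) b k * e k x) (fun=> 0) -> forall k, b k = 0.
Proof.
move=> bE k.
have part (p : R[i] -> R) : (forall z r, p (z * r%:C) = p z * r) -> p 0 = 0 ->
    (forall F : 'I_K -> R[i], p (\sum_k F k) = \sum_k p (F k)) -> p (b k) = 0.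
  move=> pM p0 pS; apply: (expv_independent xi_inj oX X0 (a := fun k => p (b k))).
  apply: (@ae_eq_open_eq _ _ X (fun x => \sum_(k < K) p (b k) * expv (xi k) x) (fun=> 0) oX).
  - by move=> x _; apply: continuous_lincomb => j; exact: continuous_expv.
  - by move=> x _; exact: cst_continuous.
  apply: filterS bE => x H /H /= /(congr1 p); rewrite p0 pS => E; rewrite -[RHS]E.
  by apply: eq_bigr => j _; rewrite pM.
apply: complex_eq0; apply: part => //.
- exact: complex_ReMr.
- by move=> F; exact: complex_Re_sum.
- exact: complex_ImMr.
- by move=> F; exact: complex_Im_sum.
Qed.

Let G : 'M[R]_K := \matrix_(k, j) \int[mu]_(x in X) (expv (xi k) x * expv (xi j) x).

Lemma expv_mul_integrable k j : mu.-integrable X (EFin \o (fun x => expv (xi k) x * expv (xi j) x)).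
Proof.
have [M eM] := expv_bounded (xi k) bX; have [M' eM'] := expv_bounded (xi j) bX.
apply: measurable_bounded_integrable => //.
  by apply: measurable_funTS; apply: measurable_funM; exact: expv_measurable.
exists (M * M'); split; first by rewrite num_real.
move=> N MN x Xx; apply: le_trans (ltW MN).
by rewrite /= normrM; apply: ler_pM => //; [exact: eM|exact: eM'].
Qed.

(** For b in the kernel, the integral of the square of \sum_k b_k exp(xi_k.x) is zero. *)
Lemma expv_gram_unit : G \in unitmx.
Proof.
rewrite -row_free_unit; apply: inj_row_free => b bG.
pose q x := \sum_(k < K) b 0 k * expv (xi k) x.
have cq : continuous q by apply: continuous_lincomb => k; exact: continuous_expv.
have qE x : q x ^+ 2 = \sum_(j < K) b 0 j * (\sum_(k < K) b 0 k * (expv (xi k) x * expv (xi j) x)).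
  rewrite expr2 {2}/q mulr_sumr; apply: eq_bigr => j _.
  rewrite mulrCA /q mulr_suml; congr (_ * _); apply: eq_bigr => k _; ring.
have i2 j : mu.-integrable X (EFin \o (fun x =>
    \sum_(k < K) b 0 k * (expv (xi k) x * expv (xi j) x))).
  by apply: integrable_lincomb => // k; exact: expv_mul_integrable.
have q20 : \int[mu]_(x in X) (q x ^+ 2) = 0.
  under eq_Rintegral do rewrite qE.
  rewrite Rintegral_lincomb// big1// => j _.
  rewrite Rintegral_lincomb//; last by move=> k; exact: expv_mul_integrable.
  rewrite (_ : \sum_(_ < _) _ = 0) ?mulr0//.
  move/rowP/(_ j) : bG; rewrite mxE [RHS]mxE => E; rewrite -[RHS]E.
  by apply: eq_bigr => k _; rewrite mxE.
have iq : mu.-integrable X (EFin \o (fun x => q x ^+ 2)).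
  have := integrable_lincomb mX (fun j => b 0 j) i2.
  by apply: eq_integrable => // x _ /=; rewrite qE.
have q0 : ae_eq mu X (EFin \o (fun x => q x ^+ 2)) (cst 0%E).
  apply/(ae_eq_integral_abs mu mX); first exact: measurable_int iq.
  transitivity (\int[mu]_(x in X) (q x ^+ 2)%:E)%E.
    by apply: eq_integral => x _; rewrite /= ger0_norm ?sqr_ge0.
  have ifin := integrable_fin_num mX iq.
  by move: q20; rewrite /Rintegral => q20; rewrite -(fineK ifin) q20.
have qX : forall x, X x -> q x = 0.
  apply: (@ae_eq_open_eq _ _ X q (fun=> 0) oX).
  - by move=> x _; exact: cq.
  - by move=> x _; exact: cst_continuous.
  by apply: filterS q0 => x H /H /= [] /eqP; rewrite sqrf_eq0 => /eqP.
by apply/rowP => k; rewrite mxE; exact: (expv_independent xi_inj oX X0 qX).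
Qed.

Lemma expv_L2 j : L2 X (e j).
Proof.
have [M eM] := expv_bounded (xi j) bX.
by apply: real_bounded_L2 eM => //; exact: expv_measurable.
Qed.

(** The images of the exponentials themselves form a basis of the range: their coordinates
    in the basis exp(xi_k.x) are the columns of the Gram matrix scaled by the c k. *)
Lemma exponentials_rank : L2_has_rank X X (corr_op X f) K.
Proof.
pose GC : 'M[R[i]]_K := map_mx (real_complex R) G.
have GCu : GC \in unitmx by rewrite map_unitmx expv_gram_unit.
have mG k j : m k (e j) = GC k j.
  rewrite /m /cintegral /e !mxE /=; apply/eqP; rewrite eq_complex /=; apply/andP; split.
    by apply/eqP; apply: eq_Rintegral => x _; rewrite mul0r subr0.
  rewrite /Rintegral; under eq_integral do rewrite mulr0 mul0r addr0.
  by rewrite integral0.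
exists (fun j => corr_op X f (e j)); split.
- by move=> j; exists (e j) => //; exact: expv_L2.
- move=> a aE.
  have b0 : forall k, (c k)%:C * \sum_(j < K) GC k j * a j = 0.
    apply: exponentials_independent; apply: filterS aE => x H Xx.
    rewrite -[RHS](H Xx) /=; under eq_bigr do rewrite mulr_sumr mulr_suml.
    rewrite exchange_big; apply: eq_bigr => j _.
    rewrite corr_exponentials ?mulr_sumr//; last exact: expv_L2.
    by apply: eq_bigr => k _; rewrite mG; ring.
  have Ga : GC *m (\col_j a j) = 0.
    apply/colP => k; rewrite !mxE; have /eqP := b0 k.
    rewrite mulf_eq0 => /orP[/eqP/complexI ck0|/eqP E]; last rewrite -[RHS]E.
      by have := c0 k; rewrite ck0 ltxx.
    by apply: eq_bigr => j _; rewrite !mxE.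
  move=> k; have /colP/(_ k) : \col_j a j = 0 by rewrite -(mulKmx GCu (\col_j a j)) Ga mulmx0.
  by rewrite !mxE.
move=> _ [g gL2 <-].
pose v := invmx GC *m \col_k m k g.
have mE k : m k g = \sum_j GC k j * v j 0.
  transitivity ((GC *m v) k 0); last by rewrite mxE.
  by rewrite /v mulKVmx// mxE.
exists (fun j => v j 0); apply: aeW => x Xx.
rewrite corr_exponentials//.
under eq_bigr do rewrite mE mulr_sumr mulr_suml.
rewrite exchange_big; apply: eq_bigr => j _.
rewrite corr_exponentials ?mulr_sumr//; last exact: expv_L2.
by apply: eq_bigr => k _; rewrite mG; ring.
Qed.

End exponential_kernels.

Section dimension.
Context {R : realType} {d : nat}.
Local Notation V := 'rV[R]_d.
Local Notation mu := (@rV_lebesgue R d).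

Lemma ae_forall_ord n (P : 'I_n -> V -> Prop) :
  (forall k, {ae mu, forall x, P k x}) -> {ae mu, forall x k, P k x}.
Proof.
elim: n P => [|n IH] P aeP; first by apply: aeW => x [].
have := IH (fun k => P (lift ord0 k)) (fun k => aeP _).
apply: filterS2 (aeP ord0) => x P0 PS k.
by case: (unliftP ord0 k) => [j|] ->.
Qed.

Lemma kernel_row (F : fieldType) K n (A : 'M[F]_(K, n)) : (n < K)%N ->
  exists2 b : 'rV[F]_K, b != 0 & b *m A = 0.
Proof.
move=> nK; have : kermx A != 0.
  by rewrite kermx_eq0 /row_free neq_ltn (leq_ltn_trans (rank_leq_col A) nK).
move=> /rowV0Pn[b /sub_kermxP bA b0]; by exists b.
Qed.

Lemma L2_dim_le (D : set V) W K n : L2_dim D W K -> L2_dim D W n -> (K <= n)%N.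
Proof.
move=> [e [We eind _]] [e' [_ _ spane']].
rewrite leqNgt; apply/negP => nK.
have /choice[a aE] k := spane' (e k) (We k).
have [b b0 bA] := kernel_row (\matrix_(k, j) a k j) nK.
have : forall k, b 0 k = 0.
  apply: eind.
  have := ae_forall_ord aE; apply: filterS => x H Dx.
  under eq_bigr do rewrite (H _ Dx) mulr_sumr.
  rewrite exchange_big big1//= => j _.
  have /rowP/(_ j) := bA; rewrite mxE [RHS]mxE => E.
  transitivity ((\sum_k b 0 k * (\matrix_(k, j) a k j) k j) * e' j x); last by rewrite E mul0r.
  rewrite mulr_suml.
  by apply: eq_bigr => k _; rewrite mxE mulrA.
by move=> bk0; move/eqP: b0; apply; apply/rowP => k; rewrite bk0 mxE.
Qed.

Lemma L2_dim_unique (D : set V) W K n : L2_dim D W K -> L2_dim D W n -> K = n.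
Proof.
by move=> h1 h2; apply/eqP; rewrite eqn_leq (L2_dim_le h1 h2) (L2_dim_le h2 h1).
Qed.

End dimension.

(** * From positivity and rank to exponentials *)

Section necessity.
Context {R : realType} {d : nat}.
Local Notation V := 'rV[R]_d.
Local Notation mu := (@rV_lebesgue R d).
Variable X : set V.
Hypotheses (oX : open X) (bX : bounded_set X) (cX : connected X) (X0 : X !=set0) (XT : X != setT).
Local Notation N := (lip_test X).

Let mX : measurable X. Proof. exact: open_measurable_rV. Qed.
Let Xfin : (mu X < +oo)%E. Proof. exact: bounded_rV_lebesgue_lty. Qed.

Section real_part.
Variable phi : V -> R.
Hypothesis iphi : mu.-integrable setT (EFin \o phi).
Local Notation G := (correlation phi).
Local Notation B := (fun g h => pairing (G g) h).

(** A form that is both symmetric and alternating is zero. *)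
Lemma alternating_correlation0 : (forall g, N g -> B g g = 0) ->
  forall x, X x -> ae_eq mu X (fun y => phi (x + y)) (fun=> 0).
Proof.
move=> alt x Xx.
have BC := pairingC oX bX iphi.
have BD := pairingDl oX bX iphi.
have B0 g h : N g -> N h -> B g h = 0.
  move=> Ng Nh; have Ngh := lip_testD Ng Nh.
  have := alt _ Ngh; rewrite /= BD// (BC g _)// (BC h _)// !BD// !alt// add0r addr0 (BC h g)//.
  by lra.
have := separated_kernel oX bX XT iphi (n := 0) (u := fun _ _ => 0) (M := fun=> 0).
move=> /(_ _ _ _ x Xx) H.
have {}H : ae_eq mu X (fun y => phi (x + y)) (fun y => \sum_(i < 0) 0 * 0).
  apply: H; try by case.
  by move=> a b Na Nb; rewrite big_ord0; exact: B0.
by apply: filterS H => y /[apply] ->; rewrite big_ord0.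
Qed.

Lemma orthonormal_correlation_free n (g : 'I_n -> V -> R) (b : 'I_n -> R) :
  orthonormal_for N B g -> (forall x, X x -> \sum_(i < n) b i * G (g i) x = 0) -> forall j, b j = 0.
Proof.
move=> [Ng gg] bG j.
transitivity (\sum_(i < n) b i * B (g i) (g j)).
  rewrite (bigD1 j)//= gg eqxx mulr1 big1 ?addr0// => i ij.
  by rewrite gg (negPf ij) mulr0.
rewrite -Rintegral_lincomb//; last first.
  by move=> i; exact: (correlation_integrable_mul oX bX iphi (Ng i) (Ng j)).
rewrite /Rintegral -[RHS]/(fine 0%E); congr fine; apply: integral0_eq => x _.
under eq_bigr do rewrite mulrA.
rewrite -mulr_suml; congr (_%:E).
have [Xx|nXx] := pselect (X x); first by rewrite bG// mul0r.
by rewrite (Ng j).1// mulr0.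
Qed.

(** Both sides of the translation identity for the curve of the correlations of the g i are
    continuous and equal phi (x + v + z) for almost every z. *)
Lemma separated_kernel_exponentials n (g : 'I_n -> V -> R) : orthonormal_for N B g ->
  (forall x, X x ->
     ae_eq mu X (fun y => phi (x + y)) (fun y => \sum_(i < n) G (g i) x * G (g i) y)) ->
  exists (xi : 'I_n -> V) (c : 'I_n -> R),
  [/\ injective xi, forall k, 0 < c k &
      forall x, X x -> ae_eq mu X (fun y => phi (x + y))
        (fun y => \sum_(k < n) c k * expR (dotv (xi k) (x + y)))].
Proof.
move=> og sep; have [Ng _] := og.
pose u i := G (g i).
have cu i : continuous (u i) by exact: (correlation_continuous bX iphi (Ng i)).
have dE x y : dotv (\row_i u i x) (\row_i u i y) = \sum_(i < n) u i x * u i y.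
  by apply: eq_bigr => i _; rewrite !mxE.
have [||xi [c [xi_inj c0 cE]]] := @translation_kernel_exponentials R d n X u oX cX X0 cu.
- move=> x y v Xx Xy Xxv Xyv; rewrite !dE.
  pose U := [set z | X z /\ X (v + z)].
  have oU : open U.
    rewrite openE => z [Xz Xvz].
    have [r r0 rX] := open_norm_ball oX Xz; have [r' r'0 rX'] := open_norm_ball oX Xvz.
    apply/nbhs_ballP; exists (Num.min r r') => /=; first by rewrite lt_min r0.
    move=> z'; rewrite -ball_normE /ball_/= distrC lt_min => /andP[zr zr'].
    split; first exact: rX.
    by apply: rX'; rewrite opprD addrACA subrr add0r.
  apply: (@ae_eq_open_eq _ _ U (fun y => \sum_i u i (x + v) * u i y)
    (fun y => \sum_i u i x * u i (y + v)) oU).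
  + by move=> z _; apply: continuous_lincomb.
  + move=> z _; apply: continuous_lincomb => i z'.
    apply: (@continuous_comp V V R^o (fun z => z + v) (u i)); last exact: cu.
    by apply: (@cvgD _ V _ (nbhs z')); [exact: cvg_id|exact: cvg_cst].
  + have s1 := sep _ Xxv; have s2 := negligible_rV_translation v (sep _ Xx).
    apply: filterS2 s1 s2 => z H1 H2 [Xz Xvz].
    by rewrite -(H1 Xz) [z + v]addrC -(H2 Xvz) addrA.
  + by split => //; rewrite addrC.
- move=> b bw; apply/rowP => j; rewrite mxE.
  apply: (orthonormal_correlation_free (b := fun j => b 0 j) og) => x Xx.
  rewrite -[RHS](bw x Xx) /dotv; apply: eq_bigr => i _; by rewrite mxE mulrC.
exists xi, c; split => // x Xx.
by apply: filterS (sep _ Xx) => y H Xy; rewrite (H Xy) -cE// dE.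
Qed.

End real_part.

Variables (K : nat) (f : V -> R[i]).
Hypothesis f_L2 : L2 (set_add X X) f.
Hypothesis f_psd : L2_psd X (corr_op X f).
Hypothesis f_rank : L2_has_rank X X (corr_op X f) K.

Let phi : V -> R := (fun x => complex.Re (f x)) \_ (set_add X X).
Let psi : V -> R := (fun x => complex.Im (f x)) \_ (set_add X X).

Let fint : cintegrable (set_add X X) f.
Proof. by apply: L2_cintegrable => //; [exact: measurable_set_add|exact: set_add_lty]. Qed.

Let iphi : mu.-integrable setT (EFin \o phi).
Proof.
have [/(integrable_mkcond _ (measurable_set_add oX)) + _] := fint.
by rewrite restrict_EFin.
Qed.

Let ipsi : mu.-integrable setT (EFin \o psi).
Proof.
have [_ /(integrable_mkcond _ (measurable_set_add oX))] := fint.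
by rewrite restrict_EFin.
Qed.

Let toC (g : V -> R) (x : V) : R[i] := (g x)%:C.

Lemma lip_test_L2 g : N g -> L2 X (toC g).
Proof.
move=> Ng; have [M gM] := lip_test_bounded bX Ng.
by apply: real_bounded_L2 (fun x _ => gM x) => //; exact: lip_test_measurable Ng.
Qed.

Lemma set_add_mem x y : X x -> X y -> (x + y) \in set_add X X.
Proof. by move=> Xx Xy; apply/mem_set; exists x => //; exists y. Qed.

Lemma corr_op_real g x : N g -> X x ->
  corr_op X f (toC g) x = correlation phi g x +i* correlation psi g x.
Proof.
move=> Ng Xx; rewrite /corr_op /cintegral; congr (_ +i* _).
  rewrite Rintegral_mkcond; apply: eq_Rintegral => y _; rewrite patchE.
  case: ifPn => [/set_mem Xy|nXy].
    by rewrite complex_ReMr /phi patchE set_add_mem.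
  by rewrite Ng.1 ?mulr0// => /mem_set; exact/negP.
rewrite Rintegral_mkcond; apply: eq_Rintegral => y _; rewrite patchE.
case: ifPn => [/set_mem Xy|nXy].
  by rewrite complex_ImMr /psi patchE set_add_mem.
by rewrite Ng.1 ?mulr0// => /mem_set; exact/negP.
Qed.

Lemma L2_inner_real g : N g -> L2_inner X (corr_op X f (toC g)) (toC g) =
  pairing (correlation phi g) g +i* pairing (correlation psi g) g.
Proof.
move=> Ng.
have conjE z x : z * conjc (toC g x) = z * (g x)%:C by rewrite /toC conjc_real.
rewrite /L2_inner /cintegral; congr (_ +i* _); rewrite Rintegral_mkcond;
  apply: eq_Rintegral => x _; rewrite patchE; case: ifPn => [/set_mem Xx|nXx].
- by rewrite conjE complex_ReMr corr_op_real.
- by rewrite Ng.1 ?mulr0// => /mem_set; exact/negP.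
- by rewrite conjE complex_ImMr corr_op_real.
- by rewrite Ng.1 ?mulr0// => /mem_set; exact/negP.
Qed.

Lemma psd_pairing g : N g ->
  0 <= pairing (correlation phi g) g /\ pairing (correlation psi g) g = 0.
Proof.
move=> Ng; have := f_psd (lip_test_L2 Ng); rewrite L2_inner_real// lecE/=.
by move=> /andP[/eqP].
Qed.

(** Positivity makes <Gamma g, g> real, so the form attached to the imaginary part of f is
    alternating. *)
Lemma imaginary_part0 x : X x -> ae_eq mu X (fun y => psi (x + y)) (fun=> 0).
Proof.
by move=> Xx; apply: (alternating_correlation0 ipsi) Xx => g Ng; exact: (psd_pairing Ng).2.
Qed.

Lemma imaginary_correlation0 g x : N g -> X x -> correlation psi g x = 0.
Proof.
move=> Ng Xx; rewrite /correlation /Rintegral -[RHS]/(fine 0%E); congr fine.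
rewrite -[RHS](integral0 mu setT); apply: ae_eq_integral => //.
  exact: measurable_int (correlation_integrable bX ipsi x Ng).
apply: filterS (imaginary_part0 Xx) => y H _ /=.
have [Xy|nXy] := pselect (X y); first by rewrite (H Xy) mul0r.
by rewrite Ng.1// mulr0.
Qed.

(** More than K elements of the range satisfy a nontrivial complex relation; its real and
    imaginary parts are relations between the correlations of the g i, which orthonormality
    excludes. *)
Lemma rank_bound n (g : 'I_n -> V -> R) :
  orthonormal_for N (fun g h => pairing (correlation phi g) h) g -> (n <= K)%N.
Proof.
move=> og; have [Ng _] := og.
have [e [_ _ spane]] := f_rank.
rewrite leqNgt; apply/negP => nK.
have /choice[a aE] j := spane (corr_op X f (toC (g j)))
  ltac:(by exists (toC (g j)) => //; exact: lip_test_L2).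
have [b b0 bA] := kernel_row (\matrix_(j, k) a j k) nK.
have bG : ae_eq mu X (fun x => \sum_(j < n) b 0 j * (correlation phi (g j) x)%:C) (fun=> 0).
  have := ae_forall_ord aE; apply: filterS => x H Xx.
  have gE j : (correlation phi (g j) x)%:C = \sum_(k < K) a j k * e k x.
    by rewrite -(H j Xx) corr_op_real// imaginary_correlation0.
  under eq_bigr do rewrite gE mulr_sumr.
  rewrite exchange_big big1//= => k _.
  have /rowP/(_ k) := bA; rewrite mxE [RHS]mxE => E.
  transitivity ((\sum_j b 0 j * (\matrix_(j, k) a j k) j k) * e k x); last by rewrite E mul0r.
  by rewrite mulr_suml; apply: eq_bigr => j _; rewrite mxE mulrA.
have part (p : R[i] -> R) : (forall z r, p (z * r%:C) = p z * r) -> p 0 = 0 ->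
    (forall F : 'I_n -> R[i], p (\sum_k F k) = \sum_k p (F k)) -> forall j, p (b 0 j) = 0.
  move=> pM p0 pS; apply: (orthonormal_correlation_free iphi og).
  apply: (@ae_eq_open_eq _ _ X
    (fun x => \sum_(j < n) p (b 0 j) * correlation phi (g j) x) (fun=> 0) oX).
  - by move=> x _; apply: continuous_lincomb => j; exact: (correlation_continuous bX iphi (Ng j)).
  - by move=> x _; exact: cst_continuous.
  apply: filterS bG => x H /H /= /(congr1 p); rewrite p0 pS => E; rewrite -[RHS]E.
  by apply: eq_bigr => j _; rewrite pM.
move/eqP: b0; apply; apply/rowP => j; rewrite [RHS]mxE; apply: complex_eq0; apply: part => //.
- exact: complex_ReMr.
- by move=> F; exact: complex_Re_sum.
- exact: complex_ImMr.
- by move=> F; exact: complex_Im_sum.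
Qed.

Lemma psd_rank_exponentials : exists (xi : 'I_K -> V) (c : 'I_K -> R),
  [/\ injective xi, forall k, 0 < c k &
      L2_eq (set_add X X) f (fun x => \sum_(k < K) (c k * expR (dotv (xi k) x))%:C)].
Proof.
have [n [g [og gE]]] := maximal_orthonormal (lip_test0 X) (@lip_testD _ _ X) (@lip_testZ _ _ X)
  (pairingC oX bX iphi) (pairingDl oX bX iphi) (pairingZl oX bX iphi)
  (fun g Ng => (psd_pairing Ng).1) rank_bound.
have [Ng _] := og.
have /choice[M gM] i := correlation_bounded bX iphi (Ng i).
have sep := separated_kernel oX bX XT iphi
  (fun i => correlation_continuous bX iphi (Ng i)) gM gE.
have [xi [c [xi_inj c0 cE]]] := separated_kernel_exponentials iphi og sep.
have fE : L2_eq (set_add X X) f (fun x => \sum_(k < n) (c k * expR (dotv (xi k) x))%:C).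
  apply: set_add_ae_eq => // x Xx.
  apply: filterS2 (cE x Xx) (imaginary_part0 Xx) => y H1 H2 Xy.
  have := H1 Xy; have := H2 Xy; rewrite /phi /psi !patchE set_add_mem//= => im re.
  rewrite -rmorph_sum/= -re; case: (f _) im => p q /= -> //.
have nK : n = K.
  exact: L2_dim_unique (exponentials_rank oX bX X0 xi_inj c0 f_L2 fE) f_rank.
by subst n; exists xi, c.
Qed.

End necessity.

Theorem theorem8p1 (R : realType) (d : nat) (hd : (0 < d)%N)
    (Xi : set 'rV[R]_d) (Xi_neq0 : Xi !=set0) (Xi_open : open Xi)
    (Xi_bounded : bounded_set Xi) (Xi_connected : connected Xi)
    (f : 'rV[R]_d -> R[i]) (f_L2 : L2 (set_add Xi Xi) f) (K : nat) :
  (L2_psd Xi (corr_op Xi f) /\ L2_has_rank Xi Xi (corr_op Xi f) K)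
  <->
  (exists (xi : 'I_K -> 'rV[R]_d) (c : 'I_K -> R),
     [/\ injective xi,
         forall k, 0 < c k &
         L2_eq (set_add Xi Xi) f
           (fun x => \sum_(k < K) (c k * expR (dotv (xi k) x))%:C)]).
Proof.
have XT := bounded_rV_neq_setT hd Xi_bounded.
split=> [[psd rank]|[xi [c [xi_inj c0 fE]]]].
  exact: psd_rank_exponentials.
by split; [exact: exponentials_psd fE|exact: exponentials_rank fE].
Qed.
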